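(* Let $\mathcal M$ be a smooth Riemannian manifold, let $E=\pi_2^*(T\mathcal M)$ be the pullback of the tangent bundle under $\pi_2:\mathcal M\times\mathcal M\to\mathcal M$, $\pi_2(x,y)=y$, and fix a separation scale $r_0>0$ (which determines the admissible embeddings). (i) There exists a finitely parametrized family of interaction laws $\mathcal I\subset\Gamma(E)$ that is universal. (ii) Let $(\mathsf V,\mathsf E)$ be an attention digraph with an admissible embedding $\alpha:\mathsf V\to\mathcal M$, and let $(\widetilde{\mathsf V},\widetilde{\mathsf E})$ be a colored hub extension of $(\mathsf V,\mathsf E)$ with hub set $H$, $n=|H|$ hubs, and $h$ colors. Then there is a density cover $\beta_1,\ldots,\beta_h\in C^\infty(\mathcal M\times\mathcal M)$ of $\alpha$ with $\operatorname{rank}(\beta_j)\le n$ for $1\le j\le h$.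
   Context: **Interaction laws.** An interaction law is a smooth section $u\in\Gamma(E)$, i.e. a smooth assignment to each $(x,y)\in\mathcal M\times\mathcal M$ of a tangent vector $u(x,y)\in T_y\mathcal M$. A family of interaction laws is a subset of $\Gamma(E)$. It is finitely parametrized if it is described by finitely many parameters: it has the form $\{u_\theta:\theta\in P\}$, where $P$ is a subset of a finite-dimensional smooth manifold (a finite disjoint union of pieces of different dimensions is allowed) and $u_\theta(x,y)$ depends smoothly on $(\theta,x,y)$ (smoothness on $P$ meaning local extendability to a smooth map on an open neighborhood). **Strong.** $u\in\Gamma(E)$ is strong at $(x_0,y_0)$ if the function $(x,y)\mapsto\|u(x,y)\|_{T_y\mathcal M}$ attains a local maximum at $(x_0,y_0)$ and is not constant on any neighborhood of $(x_0,y_0)$. **Digraphs and embeddings.** An attention digraph is a finite digraph $(\mathsf V,\mathsf E)$, $\mathsf E\subseteq\mathsf V\times\mathsf V$. An admissible embedding is an injective map $\alpha:\mathsf V\to\mathcal M$ with $d(\alpha(v),\alpha(w))>r_0$ for all distinct $v,w\in\mathsf V$, where $d$ is the Riemannian distance. **Density cover.** A density cover of $\alpha:\mathsf V\to\mathcal M$ (for $(\mathsf V,\mathsf E)$) is a collection of smooth functions $\beta_1,\dots,\beta_h\in C^\infty(\mathcal M\times\mathcal M)$ such that for every $(a,b)\in\mathsf E$ there is $1\le j\le h$ for which $\beta_j$ attains a local maximum at $(\alpha(a),\alpha(b))$ and is not constant on any neighborhood of $(\alpha(a),\alpha(b))$. A family $\mathcal I\subset\Gamma(E)$ contains a density cover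 of $\alpha$ if there are $u_1,\dots,u_h\in\mathcal I$ whose norms $\beta_j(x,y)=\|u_j(x,y)\|_{T_y\mathcal M}$ are in $C^\infty(\mathcal M\times\mathcal M)$ and form a density cover of $\alpha$. **Universal.** A family $\mathcal I\subset\Gamma(E)$ is universal if: 1. there is a constant $C>0$ such that for every attention digraph $(\mathsf V,\mathsf E)$ with $|\mathsf V|<C$ and every admissible embedding $\alpha:\mathsf V\to\mathcal M$, the family $\mathcal I$ contains a density cover of $\alpha$; and 2. for all $x_0,y_0\in\mathcal M$ and every $0\neq v_0\in T_{y_0}\mathcal M$ there is $u\in\mathcal I$ that is strong at $(x_0,y_0)$ and satisfies $u(x_0,y_0)=c\,v_0$ for some constant $c>0$. **Hub extension.** A hub extension of $(\mathsf V,\mathsf E)$ is a digraph $(\widetilde{\mathsf V},\widetilde{\mathsf E})$ with a finite hub set $H$ disjoint from $\mathsf V$ and $\widetilde{\mathsf V}=\mathsf V\cup H$, such that 1. for $a,b\in\mathsf V$: $(a,b)\in\mathsf E$ if and only if there is $h\in H$ with $(a,h),(h,b)\in\widetilde{\mathsf E}$; and 2. every edge of $\widetilde{\mathsf E}$ has the form $(a,h)$ or $(h,a)$ with $h\in H$, $a\in\mathsf V$. A coloring of a hub extension assigns a color to each hub so that any two distinct hubs $h,h'$ sharing a source vertex (some $a\in\mathsf V$ with $(a,h),(a,h')\in\widetilde{\mathsf E}$) or sharing a target vertex (some $b\in\mathsf V$ with $(h,b),(h',b)\in\widetilde{\mathsf E}$) receive distinct colors. A colored hub extension is a hub extension with such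 a coloring. **Rank.** The rank of $\beta\in C^\infty(\mathcal M\times\mathcal M)$ is its rank as a tensor in $C^\infty(\mathcal M)\otimes C^\infty(\mathcal M)$: $\operatorname{rank}(\beta)\le n$ means $\beta(x,y)=\sum_{k=1}^n f_k(x)g_k(y)$ for some $f_k,g_k\in C^\infty(\mathcal M)$.
   Formalization: Part (ii) is stated for manifolds of positive dimension: in dimension 0 every function is locally constant, so no density cover exists for a digraph with an edge and the claim fails. *)

(* Defs.v *)
From HB Require Import structures.
From mathcomp Require Import all_boot all_order all_algebra.
From mathcomp Require Import all_classical all_reals all_analysis.
Set Implicit Arguments.
Unset Strict Implicit.
Unset Printing Implicit Defensive.
Import Order.TTheory GRing.Theory Num.Theory.
Import numFieldNormedType.Exports.
Local Open Scope classical_set_scope.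
Local Open Scope ring_scope.

(** ** Smooth maps between open sets of finite-dimensional spaces *)

(* Meant for finite-dimensional V and open U: f is C^(k+1) on U iff it is
   differentiable on U and its directional derivatives are C^k on U. *)
Fixpoint Ck_on (R : realType) (V W : normedModType R) (k : nat)
    (U : set V) (f : V -> W) : Prop :=
  match k with
  | 0 => forall x, U x -> {for x, continuous f}
  | k'.+1 => (forall x, U x -> differentiable f x) /\
             (forall v : V, Ck_on k' U (fun x => 'D_v f x))
  end.

Definition smooth_on (R : realType) (V W : normedModType R)
    (U : set V) (f : V -> W) : Prop :=
  forall k, Ck_on k U f.

(** ** Smooth manifolds *)

(* A smooth structure is given by an atlas, indexed by the type [chart].
   [phi i] and [psi i] are total functions, meaningful only on [dom i] and on
   the open set [phi i @` dom i], where they are mutually inverse. Neither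
   connectedness nor nonemptiness is required. *)
Record manifold (R : realType) (d : nat) := Manifold {
  carrier :> topologicalType;
  chart : Type;
  dom : chart -> set carrier;
  phi : chart -> carrier -> 'rV[R]_d;
  psi : chart -> 'rV[R]_d -> carrier;
  dom_open : forall i, open (dom i);
  cod_open : forall i, open (phi i @` dom i);
  phiK : forall i x, dom i x -> psi i (phi i x) = x;
  phi_continuous : forall i x, dom i x -> {for x, continuous (phi i)};
  psi_continuous : forall i z, (phi i @` dom i) z -> {for z, continuous (psi i)};
  dom_cover : forall x, exists i, dom i x;
  transition_smooth : forall i j,
    smooth_on (phi i @` (dom i `&` dom j)) (phi j \o psi i);
  manifold_hausdorff : hausdorff_space carrier;
  manifold_second_countable : @second_countable carrier
}.

Definition smooth_fun (R : realType) (d : nat) (M : manifold R d)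
    (f : M -> R) : Prop :=
  forall i : chart M,
    smooth_on (phi i @` dom i) ((f \o psi i) : 'rV[R]_d -> R^o).

(* C^oo(M x M), in the product atlas *)
Definition smooth_fun2 (R : realType) (d : nat) (M : manifold R d)
    (f : M * M -> R) : Prop :=
  forall i j : chart M,
    smooth_on ((fun p : M * M => (phi i p.1, phi j p.2)) @` (dom i `*` dom j))
      ((fun z => f (psi i z.1, psi j z.2)) : 'rV[R]_d * 'rV[R]_d -> R^o).

(** ** Tangent vectors *)

(* A tangent vector at y is a family of coordinate vectors, one for each chart
   around y, related by the differentials of the transition maps. Charts that
   do not contain y get the junk value 0, so that equality is Leibniz. *)
Definition tangent_compat (R : realType) (d : nat) (M : manifold R d) (y : M)
    (v : chart M -> 'rV[R]_d) : Prop :=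
  (forall i, ~ dom i y -> v i = 0) /\
  (forall i j, dom i y -> dom j y -> v j = 'D_(v i) (phi j \o psi i) (phi i y)).

Definition tangent_pred (R : realType) (d : nat) (M : manifold R d) (y : M) :
    {pred chart M -> 'rV[R]_d} := [pred v | `[< tangent_compat y v >]].

Lemma tangent_submod_closed (R : realType) (d : nat) (M : manifold R d)
  (y : M) : submod_closed (tangent_pred y).
Proof.
have dT i j : dom i y -> dom j y ->
    differentiable (phi j \o psi i : 'rV[R]_d -> 'rV[R]_d) (phi i y).
  by move=> iy jy; have [+ _] := transition_smooth i j 1; apply; exists y.
split.
  apply/asboolP; split=> // i j iy jy.
  by rewrite deriveE; [rewrite linear0|exact: dT].
move=> a u v /asboolP[u0 uD] /asboolP[v0 vD]; apply/asboolP; split.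
  move=> i iy; change (a *: u i + v i = 0).
  by rewrite (u0 i iy) (v0 i iy) scaler0 addr0.
move=> i j iy jy.
change (a *: u j + v j =
  'D_(a *: u i + v i) (phi j \o psi i) (phi i y)).
rewrite (uD i j iy jy) (vD i j iy jy) !deriveE; try exact: dT.
by rewrite linearP.
Qed.

HB.instance Definition _ (R : realType) (d : nat) (M : manifold R d) (y : M) :=
  GRing.isSubmodClosed.Build R (chart M -> 'rV[R]_d) (tangent_pred y)
    (tangent_submod_closed y).

Record tangent (R : realType) (d : nat) (M : manifold R d) (y : M) := Tangent {
  tcoord :> chart M -> 'rV[R]_d;
  tangentP : tcoord \in tangent_pred y
}.

HB.instance Definition _ (R : realType) (d : nat) (M : manifold R d) (y : M) :=
  [isSub for @tcoord R d M y].
HB.instance Definition _ (R : realType) (d : nat) (M : manifold R d) (y : M) :=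
  [Choice of tangent y by <:].
HB.instance Definition _ (R : realType) (d : nat) (M : manifold R d) (y : M) :=
  [SubChoice_isSubLmodule of tangent y by <:].

(** ** Riemannian metrics and the Riemannian distance *)

Record riemannian (R : realType) (d : nat) (M : manifold R d) := Riemannian {
  metric : forall y : M, tangent y -> tangent y -> R;
  metric_linear : forall (y : M) (a : R) (u v w : tangent y),
    metric (a *: u + v) w = a * metric u w + metric v w;
  metric_sym : forall (y : M) (u v : tangent y), metric u v = metric v u;
  metric_pos : forall (y : M) (u : tangent y), u != 0 -> 0 < metric u u;
  metric_smooth : forall i : chart M, exists G : 'rV[R]_d -> 'M[R]_d,
    smooth_on (phi i @` dom i) G /\
    forall (y : M) (u v : tangent y), dom i y ->
      metric u v = (u i *m G (phi i y) *m (v i)^T) 0 0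
}.

Definition tnorm (R : realType) (d : nat) (M : manifold R d)
    (g : riemannian M) (y : M) (v : tangent y) : R :=
  Num.sqrt (metric g v v).

Definition smooth_curve_on (R : realType) (d : nat) (M : manifold R d)
    (O : set R) (c : R -> M) : Prop :=
  (forall t, O t -> {for t, continuous c}) /\
  (forall i : chart M,
     smooth_on (O `&` c @^-1` dom i) ((phi i \o c) : R^o -> 'rV[R]_d)).

Definition is_velocity (R : realType) (d : nat) (M : manifold R d)
    (c : R -> M) (c' : forall t, tangent (c t)) : Prop :=
  forall t, t \in `[0, 1] -> forall i, dom i (c t) ->
    c' t i = 'D_1 ((phi i \o c) : R^o -> 'rV[R]_d) t.

(* l is the length of a smooth curve [0, 1] -> M from x to y, where smoothness
   on [0, 1] means smoothness on an open neighborhood. *)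
Definition smooth_curve_length (R : realType) (d : nat) (M : manifold R d)
    (g : riemannian M) (x y : M) (l : \bar R) : Prop :=
  exists (O : set R) (c : R -> M) (c' : forall t, tangent (c t)),
    [/\ open O, `[0, 1]%classic `<=` O, smooth_curve_on O c, is_velocity c' &
      [/\ c 0 = x, c 1 = y &
        l = (\int[lebesgue_measure]_(t in `[0%R, 1%R]) (tnorm g (c' t))%:E)%E]].

(* Piecewise smooth curves are finite concatenations of smooth ones. *)
Inductive curve_length (R : realType) (d : nat) (M : manifold R d)
    (g : riemannian M) : M -> M -> \bar R -> Prop :=
| curve_length_nil x : curve_length g x x 0%E
| curve_length_cons x y z l l' : smooth_curve_length g x y l ->
    curve_length g y z l' -> curve_length g x z (l + l')%E.

(* +oo between distinct connected components *)
Definition riemannian_dist (R : realType) (d : nat) (M : manifold R d)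
    (g : riemannian M) (x y : M) : \bar R :=
  ereal_inf [set l | curve_length g x y l].

(** ** Interaction laws *)

(* Sections of the pullback bundle E of TM along (x, y) |-> y *)
Definition esection (R : realType) (d : nat) (M : manifold R d) :=
  forall x y : M, tangent y.

Definition smooth_section (R : realType) (d : nat) (M : manifold R d) :
    set (esection M) :=
  [set u | forall i j : chart M,
    smooth_on ((fun p : M * M => (phi i p.1, phi j p.2)) @` (dom i `*` dom j))
      ((fun z => u (psi i z.1) (psi j z.2) j) :
        'rV[R]_d * 'rV[R]_d -> 'rV[R]_d)].
Arguments smooth_section {R d} M.

(* Joint smoothness of (t, x, y) |-> w t x y on an open subset W of N x M x M *)
Definition smooth_family_on (R : realType) (d e : nat) (M : manifold R d)
    (N : manifold R e) (W : set (N * M * M)) (w : N -> esection M) : Prop :=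
  forall (k : chart N) (i j : chart M),
    smooth_on
      ((fun p : N * M * M => (phi k p.1.1, phi i p.1.2, phi j p.2)) @`
         (W `&` (dom k `*` dom i `*` dom j)))
      ((fun z => w (psi k z.1.1) (psi i z.1.2) (psi j z.2) j) :
        'rV[R]_e * 'rV[R]_d * 'rV[R]_d -> 'rV[R]_d).

(* Smoothness on P x M x M for an arbitrary subset P of N, by local extension *)
Definition smooth_family (R : realType) (d e : nat) (M : manifold R d)
    (N : manifold R e) (P : set N) (u : N -> esection M) : Prop :=
  forall (t : N) (x y : M), P t ->
    exists (W : set (N * M * M)) (w : N -> esection M),
      [/\ open W, W (t, x, y), smooth_family_on W w &
        forall t' x' y', P t' -> W (t', x', y') -> w t' x' y' = u t' x' y'].

Definition finitely_parametrized (R : realType) (d : nat) (M : manifold R d)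
    (I : set (esection M)) : Prop :=
  exists (m : nat) (e : 'I_m -> nat) (N : forall r, manifold R (e r))
         (P : forall r, set (N r)) (u : forall r, N r -> esection M),
    (forall r, smooth_family (P r) (u r)) /\
    I = \bigcup_r (u r @` P r).

Definition section_norm (R : realType) (d : nat) (M : manifold R d)
    (g : riemannian M) (u : esection M) : M * M -> R :=
  fun p => tnorm g (u p.1 p.2).

(* f attains a local maximum at p and is not constant on any neighborhood of p *)
Definition nonconstant_local_max (R : realType) (T : topologicalType)
    (f : T -> R) (p : T) : Prop :=
  (\forall q \near p, f q <= f p) /\
  (forall W : set T, nbhs p W -> ~ exists c : R, forall q, W q -> f q = c).

Definition strong (R : realType) (d : nat) (M : manifold R d)
    (g : riemannian M) (u : esection M) (x0 y0 : M) : Prop :=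
  nonconstant_local_max (section_norm g u) (x0, y0).

(** ** Attention digraphs, density covers, universality *)

Definition admissible (R : realType) (d : nat) (M : manifold R d)
    (g : riemannian M) (r0 : R) (V : finType) (alpha : V -> M) : Prop :=
  injective alpha /\
  forall v w : V, v != w -> (r0%:E < riemannian_dist g (alpha v) (alpha w))%E.

Definition density_cover (R : realType) (d : nat) (M : manifold R d)
    (V : finType) (E : rel V) (alpha : V -> M)
    (h : nat) (beta : 'I_h -> M * M -> R) : Prop :=
  (forall j, smooth_fun2 (beta j)) /\
  forall a b : V, E a b ->
    exists j, nonconstant_local_max (beta j) (alpha a, alpha b).

Definition contains_density_cover (R : realType) (d : nat) (M : manifold R d)
    (g : riemannian M) (I : set (esection M))
    (V : finType) (E : rel V) (alpha : V -> M) : Prop :=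
  exists (h : nat) (u : 'I_h -> esection M),
    (forall j, I (u j)) /\
    density_cover E alpha (fun j => section_norm g (u j)).

Definition universal (R : realType) (d : nat) (M : manifold R d)
    (g : riemannian M) (r0 : R) (I : set (esection M)) : Prop :=
  (exists C : R, 0 < C /\
     forall (V : finType) (E : rel V) (alpha : V -> M),
       #|V|%:R < C -> admissible g r0 alpha ->
       contains_density_cover g I E alpha) /\
  (forall (x0 y0 : M) (v0 : tangent y0), v0 != 0 ->
     exists u : esection M, [/\ I u, strong g u x0 y0 &
       exists c : R, 0 < c /\ u x0 y0 = c *: v0]).

(** ** Hub extensions *)

(* The extended vertex set is the disjoint union V + H. *)
Definition hub_extension (V H : finType) (E : rel V) (E' : rel (V + H)) : Prop :=
  (forall a b : V, E a b <-> exists h : H, E' (inl a) (inr h) /\ E' (inr h) (inl b))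
  /\
  (forall p q : V + H, E' p q -> exists (a : V) (h : H),
     (p = inl a /\ q = inr h) \/ (p = inr h /\ q = inl a)).

Definition hub_coloring (V H : finType) (E' : rel (V + H)) (h : nat)
    (color : H -> 'I_h) : Prop :=
  forall k k' : H, k != k' ->
    (exists a : V, E' (inl a) (inr k) /\ E' (inl a) (inr k')) \/
    (exists b : V, E' (inr k) (inl b) /\ E' (inr k') (inl b)) ->
    color k != color k'.

(** ** Tensor rank in C^oo(M) (x) C^oo(M) *)

Definition rank_le (R : realType) (d : nat) (M : manifold R d)
    (n : nat) (beta : M * M -> R) : Prop :=
  exists f g : 'I_n -> M -> R,
    [/\ forall k, smooth_fun (f k), forall k, smooth_fun (g k) &
      forall x y, beta (x, y) = \sum_(k < n) f k x * g k y].

(* Main.v *)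
From HB Require Import structures.
Require Import Defs.
From mathcomp Require Import all_boot all_order all_algebra.
From mathcomp Require Import all_classical all_reals all_analysis.
From mathcomp Require Import ring lra.
Import Order.TTheory GRing.Theory Num.Theory.
Import numFieldNormedType.Exports.
Local Open Scope classical_set_scope.
Local Open Scope ring_scope.

(** Both parts rest on smooth bump functions [bump i r a] on [M]: in the chart [i]
    such a function is [rho (r^2 - |z - a|^2)], with [rho t = exp (- 1 / t)] for
    [t > 0] and [0] otherwise, and it is extended by zero. It is nonnegative, with
    a positive strict global maximum at the point of coordinate [a]. When the closed ball of
    radius [r] around [a] lies in the chart, the support is in a compact, hence
    closed, subset of the Hausdorff space [M], so the extension is smooth. If [f]
    and [g] are bumps at [x] and [y], then [f * g] has a local maximum at [(x, y)]
    that is nonconstant as soon as [M] has positive dimension.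

    Universal family ([exists_universal_family]). The requirement on density
    covers only asks for some constant [C > 0]; with [C = 1] it concerns only the
    empty digraph, and the empty collection covers it. For the second
    requirement, consider the laws [law g i m r a b v], [v] nonzero: a bump in [x] times
    a bump in [y] times the field of constant direction [v] in the chart [m], divided by
    its Riemannian norm. The norm of such a law is the product of the two bumps
    ([section_norm_law]), so the law is strong at the pair of centers, where it is
    a positive multiple of [v]. Since [M] is second countable, countably many
    charts and radii suffice; they are coded by a natural number [p], so that the
    parameters [(p, a, b, v)] form a subset of one Euclidean space on which [p] is
    locally constant. Around a parameter and a point [(x, y)] of the two chart
    domains, the formula for the law is jointly smooth ([smooth_on_law]); elsewhere the law
    vanishes locally, because the parameters are restricted to centers whose ball
    of radius [2 r] is in the chart ([smooth_law_family]).

    Density covers of low rank ([hub_density_cover]). Choose a bump [f_a] at each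
    [alpha a], vanishing near the other points, and for each color sum over the
    hubs [k] of that color the product of the sum of the [f_a], [a] a source of
    [k], in the variable [x] with the sum of the [f_b], [b] a target of [k], in
    the variable [y]. There is one term of rank one per hub, and near
    [(alpha a, alpha b)], for an edge [(a, b)] through [k], the function for the
    color of [k] coincides with [f_a(x) f_b(y)], since no other hub of that color
    has [a] as a source. *)

Set Implicit Arguments.
Unset Strict Implicit.
Unset Printing Implicit Defensive.

(** * Calculus of smooth maps *)

Lemma near_eq_differentiable (R : realType) (V W : normedModType R)
    (f g : V -> W) (x : V) :
  (\near x, f x = g x) -> differentiable f x -> differentiable g x.
Proof.
move=> fg df; pose z : {linear V -> W} := \0.
have cz : continuous z by move=> y; exact: cst_continuous.
have hz : (g - f) \o shift x = cst ((g - f) x) + z +o_ 0 id.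
  apply/eqaddoP => e e0.
  have : \forall h \near (0 : V), f (h + x) = g (h + x).
    by move: fg; rewrite (near_shift 0 x) subr0.
  apply: filterS => h fgh; rewrite !fctE /= /z fgh subrr.
  rewrite (nbhs_singleton fg) subrr addr0 subrr normr0.
  by rewrite mulr_ge0// ltW.
have dgf : differentiable (g - f) x.
  by apply/diff_locallyP; rewrite (diff_unique cz hz).
by rewrite -(subrK f g); exact: differentiableD.
Qed.

Section ck.
Context {R : realType}.
Implicit Types V W X : normedModType R.

Lemma Ck_on_subset V W k (U U' : set V) (f : V -> W) :
  U' `<=` U -> Ck_on k U f -> Ck_on k U' f.
Proof.
move=> UU'; elim: k f => [|k IH] f /=; first by move=> h x /UU'; exact: h.
by move=> [h1 h2]; split=> [x /UU'|v]; [exact: h1|exact: IH].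
Qed.

(** The derivatives at a point only depend on the germ of the map there, so [U]
    need not be open. *)
Lemma Ck_on_near V W k (U : set V) (f g : V -> W) :
  (forall x, U x -> \near x, f x = g x) -> Ck_on k U f -> Ck_on k U g.
Proof.
elim: k f g => [|k IH] f g fg /=.
  move=> cf x Ux; have fgx := fg _ Ux.
  change (g @ x --> g x); rewrite -(nbhs_singleton fgx).
  by apply: cvg_trans (cf _ Ux); exact: near_eq_cvg.
move=> [h1 h2]; split=> [x Ux|v].
  exact: near_eq_differentiable (fg _ Ux) (h1 _ Ux).
apply: IH (h2 v) => x Ux.
have /nbhs_interior := fg _ Ux; apply: filterS => y fgy.
exact: near_eq_derive.
Qed.

Lemma Ck_on_eq V W k (U : set V) (f g : V -> W) :
  open U -> (forall x, U x -> f x = g x) -> Ck_on k U f -> Ck_on k U g.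
Proof.
move=> oU fg; apply: Ck_on_near => x Ux.
by apply: filterS (open_nbhs_nbhs (conj oU Ux)) => y; exact: fg.
Qed.

(** Being [C^k] is a local property. *)
Lemma Ck_on_local V W k (U : set V) (f : V -> W) :
  (forall x, U x -> exists U', U' x /\ Ck_on k U' f) -> Ck_on k U f.
Proof.
elim: k f => [|k IH] f /= h.
  by move=> x Ux; have [U' [U'x]] := h x Ux; exact.
split=> [x Ux|v]; first by have [U' [U'x [+ _]]] := h x Ux; exact.
by apply: IH => x Ux; have [U' [U'x [_]]] := h x Ux; exists U'.
Qed.

Lemma Ck_onW V W k (U : set V) (f : V -> W) : Ck_on k.+1 U f -> Ck_on k U f.
Proof.
elim: k f => [|k IH] f.
  by move=> [h _] x Ux; exact/differentiable_continuous/h.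
by move=> [h1 h2]; split=> // v; exact: IH.
Qed.

Lemma Ck_on_cst V W k (U : set V) (a : W) : Ck_on k U (fun=> a).
Proof.
elim: k a => [|k IH] a /=; first by move=> x _; exact: cst_continuous.
split=> [x _|v]; first exact: differentiable_cst.
have -> : 'D_v (fun=> a) = (fun=> 0) :> (V -> W).
  by apply/funext => x; exact: derive_cst.
exact: IH.
Qed.

Lemma Ck_on_add V W k (U : set V) (f g : V -> W) : open U ->
  Ck_on k U f -> Ck_on k U g -> Ck_on k U (fun x => f x + g x).
Proof.
move=> oU; elim: k f g => [|k IH] f g /=.
  by move=> hf hg x Ux; apply: continuousD; [exact: hf|exact: hg].
move=> [f1 f2] [g1 g2]; split=> [x Ux|v].
  by apply: differentiableD; [exact: f1|exact: g1].
apply: Ck_on_eq oU _ (IH _ _ (f2 v) (g2 v)) => x Ux.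
by rewrite [RHS]deriveD//; apply: diff_derivable; [exact: f1|exact: g1].
Qed.

Lemma Ck_on_lin V W X k (U : set V) (f : V -> W) (L : {linear W -> X}) :
  open U -> continuous L -> Ck_on k U f -> Ck_on k U (fun x => L (f x)).
Proof.
move=> oU cL; elim: k f => [|k IH] f /=.
  by move=> hf x Ux; apply: continuous_comp; [exact: hf|exact: cL].
move=> [f1 f2]; split=> [x Ux|v].
  apply: differentiable_comp; first exact: f1.
  exact: linear_differentiable.
apply: Ck_on_eq oU _ (IH _ (f2 v)) => x Ux.
have dL : differentiable L (f x) by exact: linear_differentiable.
have df := f1 _ Ux.
rewrite [RHS]deriveE; last exact: differentiable_comp.
by rewrite diff_comp// diff_lin//= deriveE.
Qed.

Lemma Ck_on_scalel V W k (U : set V) (f : V -> R^o) (w : W) : open U ->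
  Ck_on k U f -> Ck_on k U (fun x => f x *: w).
Proof.
move=> oU; have L : linear (fun a : R^o => a *: w).
  by move=> a x y; rewrite scalerDl scalerA.
pose LM := GRing.isLinear.Build _ _ _ _ _ L.
pose LL : {linear R^o -> W} := HB.pack (fun a : R^o => a *: w) LM.
apply: (@Ck_on_lin _ _ _ _ _ _ LL) => //; exact: scalel_continuous.
Qed.

Lemma Ck_on_mul V k (U : set V) (f g : V -> R^o) : open U ->
  Ck_on k U f -> Ck_on k U g -> Ck_on k U ((fun x => f x * g x) : V -> R^o).
Proof.
move=> oU; elim: k f g => [|k IH] f g.
  by move=> hf hg x Ux; apply: continuousM; [exact: hf|exact: hg].
move=> cf cg; have [f1 f2] := cf; have [g1 g2] := cg; split=> [x Ux|v].
  by apply: differentiableM; [exact: f1|exact: g1].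
apply: Ck_on_eq oU _ (Ck_on_add oU (IH _ _ (Ck_onW cf) (g2 v))
                                   (IH _ _ (Ck_onW cg) (f2 v))) => x Ux.
by rewrite [RHS]deriveM//; apply: diff_derivable; [exact: f1|exact: g1].
Qed.

Lemma Ck_on_sum V W k (U : set V) (I : Type) (r : seq I) (P : pred I)
    (f : I -> V -> W) : open U ->
  (forall i, Ck_on k U (f i)) ->
  Ck_on k U (fun x => \sum_(i <- r | P i) f i x).
Proof.
move=> oU hf; elim: r => [|i r IH].
  rewrite (_ : (fun x => _) = fun=> 0); first exact: Ck_on_cst.
  by apply/funext => x; rewrite big_nil.
case Pi : (P i).
  rewrite (_ : (fun x => _) =
      fun x => f i x + \sum_(i <- r | P i) f i x); first exact: Ck_on_add.
  by apply/funext => x; rewrite big_cons Pi.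
rewrite (_ : (fun x => _) = fun x => \sum_(i <- r | P i) f i x) //.
by apply/funext => x; rewrite big_cons Pi.
Qed.

(** [W] is spanned by finitely many vectors with continuous coordinate forms;
    this is the form of finite-dimensionality that the chain rule needs. *)
Definition has_coords W := exists (I : finType) (e : I -> W)
  (c : I -> {linear W -> R^o}),
  (forall i, continuous (c i)) /\ forall w, w = \sum_i c i w *: e i.

Lemma has_coords_scalar : has_coords R^o.
Proof.
exists unit, (fun=> 1), (fun=> idfun); split=> [_ x|w]; first exact: cvg_id.
by rewrite (bigD1 tt)//= big1 ?addr0; [rewrite /GRing.scale/= mulr1|case].
Qed.

Lemma has_coords_mx m n : has_coords 'M[R]_(m, n).
Proof.
have L i j : linear (fun M : 'M[R]_(m, n) => M i j : R^o).
  by move=> a x y; rewrite !mxE.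
pose LL i j : {linear 'M[R]_(m, n) -> R^o} :=
  HB.pack (fun M : 'M[R]_(m, n) => M i j : R^o)
    (GRing.isLinear.Build _ _ _ _ _ (L i j)).
exists ('I_m * 'I_n)%type, (fun p => delta_mx p.1 p.2), (fun p => LL p.1 p.2).
split=> [[i j]|w]; first exact: coord_continuous.
by rewrite {1}(matrix_sum_delta w) pair_bigA.
Qed.

Lemma has_coords_pair V W : has_coords V -> has_coords W ->
  has_coords (V * W)%type.
Proof.
move=> [I [e [c [cc ce]]]] [J [f [b [bb be]]]].
have L1 i : linear (fun p : V * W => c i p.1) by move=> a x y; exact: linearP.
have L2 i : linear (fun p : V * W => b i p.2) by move=> a x y; exact: linearP.
pose LL k : {linear (V * W)%type -> R^o} := match k with
 | inl i => HB.pack (fun p : V * W => c i p.1)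
     (GRing.isLinear.Build _ _ _ _ _ (L1 i))
 | inr i => HB.pack (fun p : V * W => b i p.2)
     (GRing.isLinear.Build _ _ _ _ _ (L2 i)) end.
exists (I + J)%type,
  (fun k => match k with inl i => (e i, 0) | inr j => (0, f j) end), LL.
split=> [[i|j]|[v w]].
- by move=> p; apply: continuous_comp; [exact: cvg_fst|exact: cc].
- by move=> p; apply: continuous_comp; [exact: cvg_snd|exact: bb].
rewrite big_sumType/= [LHS]surjective_pairing/=.
have sE (p q : V * W) : p + q = (p.1 + q.1, p.2 + q.2) by [].
rewrite sE; congr pair.
- rewrite raddf_sum/= raddf_sum/= [X in _ = _ + X]big1 ?addr0; last first.
    by move=> i _; rewrite scaler0.
  exact: ce.
- rewrite raddf_sum/= raddf_sum/= [X in _ = X + _]big1 ?add0r; last first.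
    by move=> i _; rewrite scaler0.
  exact: be.
Qed.

Lemma Ck_on_scale V W k (U : set V) (f : V -> R^o) (g : V -> W) :
  has_coords W -> open U ->
  Ck_on k U f -> Ck_on k U g -> Ck_on k U (fun x => f x *: g x).
Proof.
move=> [I [e [c [cc ce]]]] oU hf hg.
rewrite (_ : (fun x => _) = fun x => \sum_i (f x * c i (g x)) *: e i).
  apply: Ck_on_sum => // i; apply: Ck_on_scalel => //.
  by apply: Ck_on_mul => //; apply: Ck_on_lin => //; exact: cc.
apply/funext => x; rewrite {1}(ce (g x)) scaler_sumr.
by apply: eq_bigr => i _; rewrite scalerA.
Qed.

Lemma deriveE_coords V W (I : finType) (e : I -> V) (c : I -> {linear V -> R^o})
    (h : V -> W) (x v : V) :
  (forall w, w = \sum_i c i w *: e i) -> differentiable h x ->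
  'D_v h x = \sum_i c i v *: 'D_(e i) h x.
Proof.
move=> ce dh; rewrite deriveE// {1}(ce v) linear_sum.
by apply: eq_bigr => i _; rewrite linearZ/= deriveE.
Qed.

Lemma derive_comp V W X (f : V -> W) (h : W -> X) (x v : V) :
  differentiable f x -> differentiable h (f x) ->
  'D_v (h \o f) x = 'D_('D_v f x) h (f x).
Proof.
move=> df dh; rewrite [LHS]deriveE; last exact: differentiable_comp.
by rewrite diff_comp//= (deriveE v df) (deriveE _ dh).
Qed.

(** Chain rule: [D_v (h o f)] is the sum over a basis [e_i] of the products of the
    [i]-th coordinate of [D_v f] with [(D_(e_i) h) o f], so induction on [k] applies. *)
Lemma Ck_on_comp V W X k (U : set V) (U' : set W) (f : V -> W) (h : W -> X) :
  has_coords W -> has_coords X -> open U -> (forall x, U x -> U' (f x)) ->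
  Ck_on k U f -> Ck_on k U' h -> Ck_on k U (fun x => h (f x)).
Proof.
move=> [I [e [c [cc ce]]]] cX oU UU'; elim: k f h UU' => [|k IH] f h UU'.
  move=> hf hh x Ux; apply: continuous_comp; first exact: hf.
  exact/hh/UU'.
move=> cf ch; have [f1 f2] := cf; have [h1 h2] := ch; split=> [x Ux|v].
  by apply: differentiable_comp; [exact: f1|exact/h1/UU'].
have key : Ck_on k U (fun x => \sum_i c i ('D_v f x) *: 'D_(e i) h (f x)).
  apply: Ck_on_sum => // i; apply: Ck_on_scale => //.
    by apply: (Ck_on_lin (L := c i)) => //; exact: f2.
  by apply: IH (h2 _) => //; exact: Ck_onW.
apply: Ck_on_eq oU _ key => x Ux.
have df := f1 _ Ux; have dh := h1 _ (UU' _ Ux).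
by rewrite -(deriveE_coords _ ce)// -[RHS]/('D_v (h \o f) x) derive_comp.
Qed.

End ck.

Section smooth.
Context {R : realType}.
Implicit Types V W X : normedModType R.

Lemma smooth_on_subset V W (U U' : set V) (f : V -> W) :
  U' `<=` U -> smooth_on U f -> smooth_on U' f.
Proof. by move=> h hf k; exact: Ck_on_subset (hf k). Qed.

Lemma smooth_on_eq V W (U : set V) (f g : V -> W) :
  open U -> (forall x, U x -> f x = g x) -> smooth_on U f -> smooth_on U g.
Proof. by move=> oU fg hf k; exact: Ck_on_eq (hf k). Qed.

Lemma smooth_on_local V W (U : set V) (f : V -> W) :
  (forall x, U x -> exists U', U' x /\ smooth_on U' f) -> smooth_on U f.
Proof.
move=> h k; apply: Ck_on_local => x /h[U' [U'x hU']].
by exists U'; split=> //; exact: hU'.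
Qed.

Lemma smooth_on_differentiable V W (U : set V) (f : V -> W) x :
  smooth_on U f -> U x -> differentiable f x.
Proof. by move=> /(_ 1%N)[+ _]; exact. Qed.

Lemma smooth_on_derive V W (U : set V) (f : V -> W) v :
  smooth_on U f -> smooth_on U (fun x => 'D_v f x).
Proof. by move=> hf k; have [_] := hf k.+1; exact. Qed.

Lemma smooth_on_cst V W (U : set V) (a : W) : smooth_on U (fun=> a).
Proof. by move=> k; exact: Ck_on_cst. Qed.

Lemma smooth_on_add V W (U : set V) (f g : V -> W) : open U ->
  smooth_on U f -> smooth_on U g -> smooth_on U (fun x => f x + g x).
Proof. by move=> oU hf hg k; exact: Ck_on_add. Qed.

Lemma smooth_on_sum V W (U : set V) (I : Type) (r : seq I) (P : pred I)
    (f : I -> V -> W) : open U ->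
  (forall i, smooth_on U (f i)) ->
  smooth_on U (fun x => \sum_(i <- r | P i) f i x).
Proof. by move=> oU hf k; apply: Ck_on_sum => // i; exact: hf. Qed.

Lemma smooth_on_mul V (U : set V) (f g : V -> R^o) : open U ->
  smooth_on U f -> smooth_on U g -> smooth_on U ((fun x => f x * g x) : V -> R^o).
Proof. by move=> oU hf hg k; exact: Ck_on_mul. Qed.

Lemma smooth_on_scale V W (U : set V) (f : V -> R^o) (g : V -> W) :
  has_coords W -> open U ->
  smooth_on U f -> smooth_on U g -> smooth_on U (fun x => f x *: g x).
Proof. by move=> cW oU hf hg k; exact: Ck_on_scale. Qed.

Lemma smooth_on_lin V W X (U : set V) (f : V -> W) (L : {linear W -> X}) :
  open U -> continuous L -> smooth_on U f -> smooth_on U (fun x => L (f x)).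
Proof. by move=> oU cL hf k; exact: Ck_on_lin. Qed.

Lemma smooth_on_comp V W X (U : set V) (U' : set W) (f : V -> W) (h : W -> X) :
  has_coords W -> has_coords X -> open U -> (forall x, U x -> U' (f x)) ->
  smooth_on U f -> smooth_on U' h -> smooth_on U (fun x => h (f x)).
Proof. by move=> cW cX oU UU' hf hh k; exact: Ck_on_comp (hf k) (hh k). Qed.

Lemma smooth_on_opp V W (U : set V) (f : V -> W) : open U ->
  smooth_on U f -> smooth_on U (fun x => - f x).
Proof.
move=> oU hf; apply: (smooth_on_lin (L := -%R)) => //.
exact: oppr_continuous.
Qed.

Lemma smooth_on_id V (U : set V) : smooth_on U (fun x => x).
Proof.
case=> [|k]; first by move=> x _; exact: cvg_id.
split=> [x _|v]; first exact: (ex_diff (is_diff_def := is_diff_id x)).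
have -> : 'D_v (fun x => x) = (fun=> v) :> (V -> V).
  by apply/funext => x; exact: derive_id.
exact: Ck_on_cst.
Qed.

Lemma smooth_on_fst V W X (U : set V) (f : V -> (W * X)%type) : open U ->
  smooth_on U f -> smooth_on U (fun x => (f x).1).
Proof.
have c : continuous (fst : W * X -> W) by move=> x; exact: cvg_fst.
by move=> oU; exact: (smooth_on_lin (L := fst)).
Qed.

Lemma smooth_on_snd V W X (U : set V) (f : V -> (W * X)%type) : open U ->
  smooth_on U f -> smooth_on U (fun x => (f x).2).
Proof.
have c : continuous (snd : W * X -> X) by move=> x; exact: cvg_snd.
by move=> oU; exact: (smooth_on_lin (L := snd)).
Qed.

Lemma smooth_on_pair V W X (U : set V) (f : V -> W) (g : V -> X) : open U ->
  smooth_on U f -> smooth_on U g -> smooth_on U (fun x => (f x, g x)).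
Proof.
move=> oU hf hg.
have L1 : linear (fun w : W => (w, 0 : X)).
  by move=> a x y; apply/pair_equal_spec; rewrite /= scaler0 addr0.
have L2 : linear (fun w : X => (0 : W, w)).
  by move=> a x y; apply/pair_equal_spec; rewrite /= scaler0 addr0.
pose l1 : {linear W -> (W * X)%type} := HB.pack (fun w : W => (w, 0 : X))
  (GRing.isLinear.Build _ _ _ _ _ L1).
pose l2 : {linear X -> (W * X)%type} := HB.pack (fun w : X => (0 : W, w))
  (GRing.isLinear.Build _ _ _ _ _ L2).
have c1 : continuous l1.
  by move=> x; apply: cvg_pair; [exact: cvg_id|exact: cvg_cst].
have c2 : continuous l2.
  by move=> x; apply: cvg_pair; [exact: cvg_cst|exact: cvg_id].
rewrite (_ : (fun x => _) = fun x => l1 (f x) + l2 (g x)).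
  by apply: smooth_on_add => //; exact: smooth_on_lin.
by apply/funext => x; apply/pair_equal_spec; rewrite /= addr0 add0r.
Qed.

Lemma smooth_on_mx V m n (U : set V) (f : V -> 'M[R]_(m, n)) : open U ->
  (forall i j, smooth_on U ((fun x => f x i j) : V -> R^o)) -> smooth_on U f.
Proof.
move=> oU hf.
rewrite (_ : f = fun x => \sum_i \sum_j f x i j *: delta_mx i j).
  apply: smooth_on_sum => // i; apply: smooth_on_sum => // j.
  by apply: smooth_on_scale => //; [exact: has_coords_mx|exact: smooth_on_cst].
by apply/funext => x; exact: matrix_sum_delta.
Qed.

Lemma smooth_on_coord V m n (U : set V) (f : V -> 'M[R]_(m, n)) i j : open U ->
  smooth_on U f -> smooth_on U ((fun x => f x i j) : V -> R^o).
Proof.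
move=> oU.
have L : linear (fun M : 'M[R]_(m, n) => M i j : R^o).
  by move=> a x y; rewrite !mxE.
pose LL : {linear 'M[R]_(m, n) -> R^o} :=
  HB.pack (fun M : 'M[R]_(m, n) => M i j : R^o)
    (GRing.isLinear.Build _ _ _ _ _ L).
by apply: (smooth_on_lin (L := LL)) => //; exact: coord_continuous.
Qed.

Lemma smooth_on_mulmx V m n p (U : set V) (f : V -> 'M[R]_(m, n))
    (g : V -> 'M[R]_(n, p)) : open U ->
  smooth_on U f -> smooth_on U g -> smooth_on U (fun x => f x *m g x).
Proof.
move=> oU hf hg; apply: smooth_on_mx => // i j.
rewrite (_ : (fun x => _) = fun x => \sum_k f x i k * g x k j).
  apply: (@smooth_on_sum _ R^o) => // k.
  by apply: smooth_on_mul => //; exact: smooth_on_coord.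
by apply/funext => x; rewrite mxE.
Qed.

Lemma smooth_on_trmx V m n (U : set V) (f : V -> 'M[R]_(m, n)) : open U ->
  smooth_on U f -> smooth_on U (fun x => (f x)^T).
Proof.
move=> oU hf; apply: smooth_on_mx => // i j.
rewrite (_ : (fun x => _) = fun x => f x j i); first exact: smooth_on_coord.
by apply/funext => x; rewrite mxE.
Qed.

Lemma smooth_on_lsubmx (V : normedModType R) (U : set V) n1 n2
    (f : V -> 'rV[R]_(n1 + n2)) : open U ->
  smooth_on U f -> smooth_on U (fun x => lsubmx (f x)).
Proof.
by move=> oU; apply: (smooth_on_lin (L := lsubmx)) => //; exact: continuous_lsubmx.
Qed.

Lemma smooth_on_rsubmx (V : normedModType R) (U : set V) n1 n2
    (f : V -> 'rV[R]_(n1 + n2)) : open U ->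
  smooth_on U f -> smooth_on U (fun x => rsubmx (f x)).
Proof.
by move=> oU; apply: (smooth_on_lin (L := rsubmx)) => //; exact: continuous_rsubmx.
Qed.

(** The reciprocal square root of a positive smooth function is smooth: it
    solves [r' = - (1/2) r^3 q']. *)
Lemma smooth_on_rsqrt V (U : set V) (q : V -> R^o) : open U ->
  (forall x, U x -> 0 < q x) -> smooth_on U q ->
  smooth_on U ((fun x => (Num.sqrt (q x))^-1) : V -> R^o).
Proof.
move=> oU qpos hq; set r := (fun x => _).
have dr x : U x -> differentiable (r : V -> R^o) x /\
    forall v, 'D_v (r : V -> R^o) x = - 2^-1 * (r x * r x * r x) * 'D_v q x.
  move=> Ux; have qx := qpos _ Ux.
  have dq : differentiable q x := smooth_on_differentiable hq Ux.
  have sq : Num.sqrt (q x) != 0 by rewrite gt_eqF// sqrtr_gt0.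
  have /derivable1_diffP dsq : derivable (Num.sqrt : R -> R) (q x) 1.
    by apply: ex_derive; exact: is_derive1_sqrt.
  have ds : differentiable (Num.sqrt \o q : V -> R) x.
    by apply: differentiable_comp.
  split; first exact: differentiableV.
  move=> v; rewrite [LHS](@deriveV _ _ (Num.sqrt \o q))//; last first.
    exact: diff_derivable.
  rewrite [in LHS]deriveE// diff_comp//= -(deriveE v dq).
  have dsE (y : R^o) : 'd (Num.sqrt : R^o -> R^o) (q x) y =
      (2 * Num.sqrt (q x))^-1 * y.
    have <- : 'D_1 (Num.sqrt : R^o -> R^o) (q x) = (2 * Num.sqrt (q x))^-1.
      by apply: derive_val; exact: is_derive1_sqrt.
    rewrite deriveE// -[X in 'd _ _ X]mulr1.
    by rewrite -[X in 'd _ _ X]/(_ *: (1 : R^o)) linearZ/= mulrC.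
  rewrite [X in _ *: X = _]dsE.
  rewrite /r /GRing.scale/=.
  by field.
elim=> [|k IH]; first by move=> x Ux; apply/differentiable_continuous/(dr x Ux).1.
split=> [x Ux|v]; first exact: (dr x Ux).1.
have key : Ck_on k U ((fun x => - 2^-1 * (r x * r x * r x) * 'D_v q x) : V -> R^o).
  apply: Ck_on_mul => //; last by have [_] := hq k.+1; exact.
  apply: Ck_on_mul => //; first exact: Ck_on_cst.
  by apply: Ck_on_mul => //; exact: Ck_on_mul.
by apply: Ck_on_eq oU _ key => x Ux; rewrite (dr x Ux).2.
Qed.

End smooth.

(** * The flat function exp(-1/t) *)

Section flat.
Context {R : realType}.
Implicit Types t : R.

(** The functions [t^-n exp(-1/t)] extended by zero to [t <= 0]; the family is
    closed under derivation up to linear combinations. *)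
Definition flat (n : nat) (t : R^o) : R^o :=
  if 0 < t then t^-1 ^+ n * expR (- t^-1) else 0.

Lemma flat_ge0 n t : 0 <= flat n t.
Proof.
rewrite /flat; case: ifPn => // t0.
by rewrite mulr_ge0 ?expR_ge0// exprn_ge0// invr_ge0 ltW.
Qed.

Lemma flat0_gt0 t : 0 < t -> 0 < flat 0 t.
Proof. by move=> t0; rewrite /flat t0 expr0 mul1r expR_gt0. Qed.

Lemma flat0_eq0 t : t <= 0 -> flat 0 t = 0.
Proof. by move=> t0; rewrite /flat ltNge t0. Qed.

Lemma flat0_lt s t : 0 < t -> s < t -> flat 0 s < flat 0 t.
Proof.
move=> t0 st; have [s0|s0] := leP s 0; first by rewrite flat0_eq0// flat0_gt0.
rewrite /flat s0 t0 !expr0 !mul1r ltr_expR ltrN2.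
by rewrite ltf_pV2 ?posrE.
Qed.

(** From [exp s >= s^(n+2) / (n+2)!] at [s = 1/t]; it makes all the functions
    [flat n] differentiable at [0] with derivative [0]. *)
Lemma flat_bound n t : `|flat n t| <= n.+2`!%:R * t ^+ 2.
Proof.
rewrite ger0_norm ?flat_ge0// /flat; case: ifPn => t0; last first.
  by rewrite mulr_ge0// sqr_ge0.
have ti : 0 < t^-1 by rewrite invr_gt0.
have F0 : 0 < n.+2`!%:R :> R by rewrite ltr0n fact_gt0.
have : t^-1 ^+ n.+2 / n.+2`!%:R <= expR t^-1.
  by apply: le_trans (expR_ge1Dxn n.+1 (ltW ti)); rewrite lerDr.
rewrite expRN ler_pdivrMr// => h.
rewrite -[leLHS]/(_ / _) ler_pdivrMr ?expR_gt0//.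
have -> : t^-1 ^+ n = t ^+ 2 * t^-1 ^+ n.+2.
  by rewrite !exprS; field; rewrite gt_eqF.
have -> : n.+2`!%:R * t ^+ 2 * expR t^-1 = t ^+ 2 * (expR t^-1 * n.+2`!%:R) by ring.
by rewrite ler_wpM2l ?sqr_ge0.
Qed.

Lemma is_derive_flat n t :
  is_derive t (1 : R^o) (flat n) (- n%:R * flat n.+1 t + flat n.+2 t).
Proof.
have [t0|t0|->] := ltgtP t 0.
- have -> : - n%:R * flat n.+1 t + flat n.+2 t = 0.
    by rewrite /flat !ltNge !(ltW t0)/= mulr0 addr0.
  apply: (@near_eq_is_derive _ _ _ (fun=> 0)).
  near=> s; rewrite /flat ltNge ifF//; apply/negbTE; rewrite negbK.
  by apply: ltW; near: s; exact: lt_nbhsl.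
- apply: (@near_eq_is_derive _ R^o R^o
    (fun s : R^o => s^-1 ^+ n * expR (- s^-1) : R^o)).
    near=> s; rewrite /flat ifT//; near: s.
    exact: lt_nbhsr.
  have tn0 : t != 0 by rewrite gt_eqF.
  have di : is_derive t (1 : R^o) (fun s : R^o => s^-1 : R^o) (- t ^- 2).
    have := @is_deriveV _ id t 1 1 tn0 (is_derive_id t (1 : R^o)).
    by rewrite [_ *: _]mulr1.
  have dn : is_derive t (1 : R^o) (fun s : R^o => - s^-1 : R^o) (t ^- 2).
    by rewrite -[t ^- 2]opprK; exact: is_deriveN.
  have de : is_derive t (1 : R^o) (expR \o (fun s : R^o => - s^-1 : R^o))
       (expR (- t^-1) * t ^- 2).
    exact: is_derive1_comp.
  have dx := is_deriveX n di.
  have dm := is_deriveM dx de.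
  rewrite (_ : (fun s => _) = ((fun s : R^o => s^-1 : R^o) ^+ n) *
     (expR \o (fun s : R^o => - s^-1 : R^o))); last first.
    by apply/funext => s; rewrite !fctE.
  apply: is_derive_eq.
  rewrite /flat t0 /GRing.scale/= !fctE.
  case: n {dx dm} => [|n]/=; rewrite ?exprS; field => //.
- have -> : - n%:R * flat n.+1 0 + flat n.+2 0 = 0 :> R.
    by rewrite /flat !ltxx/= mulr0 addr0.
  have lim0 : (fun h : R => h^-1 *: (flat n (h *: 1 + 0) - flat n 0)) @ 0^'
      --> (0 : R^o).
    apply/cvgrPdist_le => e e0.
    near=> h.
    have h0 : h != 0 by near: h; exact: nbhs_dnbhs_neq.
    have F0 : 0 < n.+2`!%:R :> R by rewrite ltr0n fact_gt0.
    rewrite sub0r normrN [h *: _]mulr1 addr0 [flat n 0]/flat ltxx subr0.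
    rewrite normrM normfV mulrC ler_pdivrMr ?normr_gt0//.
    apply: le_trans (flat_bound n h) _.
    rewrite -(real_normK (num_real h)) expr2 mulrA ler_wpM2r//.
    rewrite mulrC -ler_pdivlMr//.
    near: h; exact: dnbhs0_le (divr_gt0 _ _).
  apply: DeriveDef; first by apply/cvg_ex; exists 0.
  by apply/cvg_lim.
Unshelve. all: by end_near. Qed.

Lemma smooth_on_flat n (U : set R^o) : smooth_on U (flat n).
Proof.
apply: (@smooth_on_subset _ _ _ setT) => //.
move=> k; elim: k n => [|k IH] n.
  move=> t _; apply/differentiable_continuous/derivable1_diffP.
  by apply: ex_derive; exact: is_derive_flat.
have df t : differentiable (flat n) t.
  by apply/derivable1_diffP; apply: ex_derive; exact: is_derive_flat.
split=> [t _|v]; first exact: df.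
have -> : 'D_v (flat n) = fun t : R^o =>
    v * (- n%:R * flat n.+1 t + flat n.+2 t) :> R^o.
  apply/funext => t.
  rewrite deriveE// -[X in 'd _ _ X]mulr1 -[X in 'd _ _ X]/(_ *: (1 : R^o)).
  rewrite linearZ/= -deriveE//; congr (_ * _).
  by apply: derive_val; exact: is_derive_flat.
apply: Ck_on_mul; [exact: openT|exact: Ck_on_cst|].
apply: Ck_on_add; [exact: openT| |exact: IH].
by apply: Ck_on_mul; [exact: openT|exact: Ck_on_cst|exact: IH].
Qed.

End flat.

(** * Bump functions and local maxima of products *)

Lemma open_setX (T U : topologicalType) (A : set T) (B : set U) :
  open A -> open B -> open (A `*` B).
Proof.
move=> oA oB; rewrite openE => -[x y] [/= Ax By].
by exists (A, B) => //; split; exact: open_nbhs_nbhs.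
Qed.

Section charts.
Context {R : realType} {d : nat} {M : manifold R d}.
Implicit Types (i j : chart M) (x y : M) (a z : 'rV[R]_d) (r : R).

Lemma psi_dom i z : (phi i @` dom i) z -> dom i (psi i z).
Proof. by move=> [x ix <-]; rewrite phiK. Qed.

Lemma psiK i z : (phi i @` dom i) z -> phi i (psi i z) = z.
Proof. by move=> [x ix <-]; rewrite phiK. Qed.

(** Membership in the image of [O] in the chart [i], in terms of the inverse chart. *)
Lemma chart_imageP i (O : set M) z :
  (phi i @` (dom i `&` O)) z <-> (phi i @` dom i) z /\ O (psi i z).
Proof.
split=> [[x [ix Ox] <-]|[iz Oz]]; first by rewrite phiK//; split=> //; exists x.
by exists (psi i z); rewrite ?psiK//; split=> //; exact: psi_dom.
Qed.

Lemma open_chart_image i (O : set M) : open O -> open (phi i @` (dom i `&` O)).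
Proof.
move=> oO; rewrite openE => z /chart_imageP[iz Oz].
have n1 : nbhs z (phi i @` dom i).
  by apply: open_nbhs_nbhs; split=> //; exact: cod_open.
have n2 : nbhs z (psi i @^-1` O).
  by apply: psi_continuous => //; exact: open_nbhs_nbhs.
by apply: filterS (filterI n1 n2) => w [iw Ow]; apply/chart_imageP.
Qed.

(** The closed ball for the sup norm. *)
Definition cball a r : set 'rV[R]_d := [set z | `|z - a| <= r].

Lemma closed_cball a r : closed (cball a r).
Proof.
have c : continuous (fun z : 'rV[R]_d => `|z - a|).
  move=> z; apply: (@cvg_norm _ _ _ (nbhs z)); apply: cvgB; last exact: cvg_cst.
  exact: cvg_id.
exact: (preimage_closed (f := fun z : 'rV[R]_d => `|z - a|) (D := [set t | t <= r])
  (fun z _ => c z) (@closed_le R r)).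
Qed.

Lemma compact_cball a r : compact (cball a r).
Proof.
apply: bounded_closed_compact (@closed_cball a r).
exists (r + `|a|); split; first exact: num_real.
move=> N hN z; rewrite /cball/= => za; apply: le_trans (ltW hN).
by rewrite -[z](subrK a); apply: le_trans (ler_normD _ _) _; rewrite lerD2r.
Qed.

Lemma closed_chart_cball i a r : cball a r `<=` phi i @` dom i ->
  closed (psi i @` cball a r).
Proof.
move=> sub; apply: compact_closed; first exact: manifold_hausdorff.
apply: continuous_compact; last exact: compact_cball.
apply: continuous_in_subspaceT => z; rewrite inE => /sub; exact: psi_continuous.
Qed.

(** The squared Euclidean norm, smooth unlike the sup norm. *)
Definition sqnorm z : R := \sum_j z 0 j * z 0 j.

Lemma sqnorm_ge0 z : 0 <= sqnorm z.
Proof. by apply: sumr_ge0 => j _; rewrite -expr2 sqr_ge0. Qed.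

Lemma sqnorm_gt0 z : z != 0 -> 0 < sqnorm z.
Proof.
move=> z0; rewrite lt_neqAle sqnorm_ge0 andbT eq_sym; apply: contra z0.
rewrite /sqnorm psumr_eq0; last by move=> j _; rewrite -expr2 sqr_ge0.
move=> /allP h; apply/eqP/rowP => j; rewrite mxE.
by have := h j; rewrite mem_index_enum mulf_eq0 orbb => /(_ isT)/eqP.
Qed.

Lemma norm_lt_sqnorm z r : 0 < r -> sqnorm z < r ^+ 2 -> `|z| < r.
Proof.
move=> r0 zr; rewrite [ltLHS]/Num.Def.normr/= mx_normrE.
apply: bigmax_lt => // -[k j] _ /=.
rewrite (ord1 k) -(ltr_pXn2r (n := 2)) ?nnegrE ?(ltW r0)//.
apply: le_lt_trans zr; rewrite real_normK ?num_real// expr2.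
rewrite /sqnorm (bigD1 j)//= lerDl; apply: sumr_ge0 => l _.
by rewrite -expr2 sqr_ge0.
Qed.

Lemma smooth_on_sqnorm (V : normedModType R) (U : set V) (f : V -> 'rV[R]_d) :
  open U -> smooth_on U f -> smooth_on U ((fun w => sqnorm (f w)) : V -> R^o).
Proof.
move=> oU hf; apply: (@smooth_on_sum _ _ R^o) => // j.
by apply: smooth_on_mul => //; exact: smooth_on_coord.
Qed.

(** The bump of radius [r] centered at the point of [M] whose coordinate in the
    chart [i] is [a]; it is zero off the chart domain. *)
Definition bump i r a x : R :=
  if `[< dom i x >] then flat 0 (r ^+ 2 - sqnorm (phi i x - a)) else 0.

Lemma bump_ge0 i r a x : 0 <= bump i r a x.
Proof. by rewrite /bump; case: ifP => // _; exact: flat_ge0. Qed.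

Lemma bumpE i r a x : dom i x ->
  bump i r a x = flat 0 (r ^+ 2 - sqnorm (phi i x - a)).
Proof. by move=> ix; rewrite /bump ifT//; exact/asboolP. Qed.

Lemma bump_out i r a x : ~ dom i x -> bump i r a x = 0.
Proof. by move=> ix; rewrite /bump ifF//; apply/asboolP. Qed.

(** The support lies in the image of a compact ball; when that ball is inside
    the chart the image is closed in [M], which makes the extension by zero smooth. *)
Lemma bump_support i r a x : 0 < r -> ~ (psi i @` cball a r) x ->
  bump i r a x = 0.
Proof.
move=> r0 Kx; have [ix|/bump_out//] := pselect (dom i x).
rewrite bumpE//; apply: flat0_eq0; rewrite leNgt; apply/negP => h.
apply: Kx; exists (phi i x); last by rewrite phiK.
by rewrite /cball/=; apply/ltW/norm_lt_sqnorm => //; rewrite -subr_gt0.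
Qed.

Lemma sqnorm0 : sqnorm 0 = 0.
Proof. by apply: big1 => j _; rewrite mxE mulr0. Qed.

Lemma bump_center_gt0 i r x : 0 < r -> dom i x -> 0 < bump i r (phi i x) x.
Proof.
move=> r0 ix; rewrite bumpE// subrr sqnorm0 subr0.
by rewrite flat0_gt0// exprn_gt0.
Qed.

Lemma bump_lt i r x y : 0 < r -> dom i x -> y != x ->
  bump i r (phi i x) y < bump i r (phi i x) x.
Proof.
move=> r0 ix yx; have [iy|/bump_out->] := pselect (dom i y); last first.
  exact: bump_center_gt0.
rewrite !bumpE// subrr sqnorm0 subr0; apply: flat0_lt; first by rewrite exprn_gt0.
rewrite gtrDl oppr_lt0; apply: sqnorm_gt0.
by apply: contra yx; rewrite subr_eq0 => /eqP e; rewrite -(phiK iy) e phiK.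
Qed.

(** Joint smoothness of a bump in its center and in the point, the latter read
    in another chart. *)
Lemma smooth_on_bump (V : normedModType R) (U : set V) i j r
    (A B : V -> 'rV[R]_d) : open U ->
  (forall w, U w -> (phi j @` (dom j `&` dom i)) (B w)) ->
  smooth_on U A -> smooth_on U B ->
  smooth_on U ((fun w => bump i r (A w) (psi j (B w))) : V -> R^o).
Proof.
move=> oU UB hA hB.
have hphi : smooth_on U (fun w => phi i (psi j (B w))).
  apply: smooth_on_comp UB hB (transition_smooth j i) => //; exact: has_coords_mx.
have key : smooth_on U ((fun w => flat 0 (r ^+ 2 +
    - sqnorm (phi i (psi j (B w)) + - A w))) : V -> R^o).
  apply: (@smooth_on_comp _ _ R^o R^o U setT _ (flat 0)) => //.
  - exact: has_coords_scalar.
  - exact: has_coords_scalar.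
  - apply: (@smooth_on_add _ _ R^o) => //; first exact: smooth_on_cst.
    apply: (@smooth_on_opp _ _ R^o) => //; apply: smooth_on_sqnorm => //.
    by apply: smooth_on_add => //; exact: smooth_on_opp.
  - exact: smooth_on_flat.
apply: smooth_on_eq oU _ key => w Uw; rewrite bumpE//.
by have /chart_imageP[] := UB _ Uw.
Qed.

Lemma smooth_fun_bump i r a : 0 < r -> cball a r `<=` phi i @` dom i ->
  smooth_fun (bump i r a).
Proof.
move=> r0 sub j; apply: smooth_on_local => z jz.
have [iz|iz] := pselect (dom i (psi j z)).
  exists (phi j @` (dom j `&` dom i)); split; first by apply/chart_imageP.
  apply: (@smooth_on_bump _ _ i j r (fun=> a) id) => //.
  - exact/open_chart_image/dom_open.
  - exact: smooth_on_cst.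
  - exact: smooth_on_id.
have cK := closed_chart_cball sub.
have oO : open (phi j @` (dom j `&` ~` (psi i @` cball a r))).
  exact/open_chart_image/closed_openC.
exists (phi j @` (dom j `&` ~` (psi i @` cball a r))); split.
  apply/chart_imageP; split => // -[w /sub iw e]; apply: iz.
  by rewrite -e; exact: psi_dom.
apply: smooth_on_eq oO _ (@smooth_on_cst _ _ R^o _ 0) => w.
by move=> /chart_imageP[_ Kw]; rewrite /= bump_support.
Qed.

(** A nonnegative smooth function with a strict global maximum at [x] and
    with closed support inside a given neighborhood of [x]. *)
Lemma exists_peak x (O : set M) : open O -> O x ->
  exists f : M -> R, [/\ smooth_fun f, forall y, 0 <= f y, 0 < f x,
    forall y, y != x -> f y < f x &
    exists2 K : set M, closed K /\ K `<=` O & forall y, ~ K y -> f y = 0].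
Proof.
move=> oO Ox; have [i ix] := dom_cover x.
have /nbhs_normP[e /= e0 eO] : nbhs (phi i x) (phi i @` (dom i `&` O)).
  apply: open_nbhs_nbhs; split; first exact: open_chart_image.
  by exists x.
have r0 : 0 < e / 2 by rewrite divr_gt0.
have sub : cball (phi i x) (e / 2) `<=` phi i @` (dom i `&` O).
  move=> z zr; apply: eO; rewrite /ball_/= distrC.
  by apply: le_lt_trans zr _; rewrite ltr_pdivrMr// ltr_pMr// ltr1n.
have subi : cball (phi i x) (e / 2) `<=` phi i @` dom i.
  by move=> z /sub/chart_imageP[].
exists (bump i (e / 2) (phi i x)); split.
- exact: smooth_fun_bump.
- by move=> y; exact: bump_ge0.
- exact: bump_center_gt0.
- by move=> y; exact: bump_lt.
exists (psi i @` cball (phi i x) (e / 2)).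
  split; first exact: closed_chart_cball.
  by move=> _ [z /sub/chart_imageP[_ Oz] <-].
by move=> y; exact: bump_support.
Qed.

(** A manifold of positive dimension has no isolated points. *)
Lemma nbhs_other_point x (W : set M) : (0 < d)%N -> nbhs x W ->
  exists2 y, W y & y != x.
Proof.
move=> d0; rewrite nbhsE => -[N [oN Nx] NW].
have [i ix] := dom_cover x.
have /nbhs_normP[e /= e0 eO] : nbhs (phi i x) (phi i @` (dom i `&` N)).
  apply: open_nbhs_nbhs; split; first exact: open_chart_image.
  by exists x.
pose w : 'rV[R]_d := const_mx (e / 2).
have w0 : w != 0.
  apply/eqP => /matrixP/(_ 0 (Ordinal d0)); rewrite !mxE; apply/eqP.
  by rewrite gt_eqF// divr_gt0.
have : (phi i @` (dom i `&` N)) (phi i x + w).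
  apply: eO; rewrite /ball_/= opprD addNKr normrN.
  rewrite [ltLHS]/Num.Def.normr/= mx_normrE; apply: bigmax_lt => // k _ /=.
  by rewrite mxE gtr0_norm ?divr_gt0// ltr_pdivrMr// ltr_pMr// ltr1n.
move=> [y [iy Ny] e1]; exists y; first exact: NW.
apply/eqP => yx; move: e1; rewrite yx => /eqP; rewrite -subr_eq0 opprD addNKr.
by rewrite oppr_eq0 (negbTE w0).
Qed.

End charts.

Lemma nonconstant_local_max_near (R : realType) (T : topologicalType)
    (f g : T -> R) (p : T) : (\near p, f p = g p) ->
  nonconstant_local_max f p -> nonconstant_local_max g p.
Proof.
move=> fg [f1 f2]; have fgp := nbhs_singleton fg; split.
  by apply: filterS (filterI fg f1) => q [<-]; rewrite -fgp.
move=> W nW [c hc]; apply: (f2 (W `&` [set q | f q = g q])).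
  exact: filterI.
by exists c => q [Wq ->]; exact: hc.
Qed.

(** The product of two nonnegative peaks is not constant near [(x, y)] because it
    already varies along [M x {y}]. *)
Lemma nonconstant_local_max_mul (R : realType) (d : nat) (M : manifold R d)
    (f g : M -> R) (x y : M) : (0 < d)%N ->
  (forall z, 0 <= f z) -> (forall z, 0 <= g z) -> 0 < g y ->
  (forall z, z != x -> f z < f x) -> (forall z, z != y -> g z < g y) ->
  nonconstant_local_max (fun p : M * M => f p.1 * g p.2) (x, y).
Proof.
move=> d0 f0 g0 gy fx gy'; split.
  apply: (@nearW _ (nbhs ((x, y) : M * M))) => -[z w] /=; apply: ler_pM => //.
    by have [->|/fx/ltW] := eqVneq z x.
  by have [->|/gy'/ltW] := eqVneq w y.
move=> W [[A B] /= [nA nB] AB] [c hc].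
have [z Az zx] := nbhs_other_point d0 nA.
have e1 := hc (z, y) (AB (z, y) (conj Az (nbhs_singleton nB))).
have e2 := hc (x, y) (AB (x, y) (conj (nbhs_singleton nA) (nbhs_singleton nB))).
move: e1; rewrite -e2 /= => /(mulIf (lt0r_neq0 gy)) e.
by have := fx _ zx; rewrite e ltxx.
Qed.

Lemma open_prod_image (R : realType) (d : nat) (M : manifold R d)
    (i j : chart M) :
  open ((fun p : M * M => (phi i p.1, phi j p.2)) @` (dom i `*` dom j)).
Proof.
rewrite (_ : _ @` _ = (phi i @` dom i) `*` (phi j @` dom j)).
  by apply: open_setX; exact: cod_open.
apply/seteqP; split=> [_ [[x y] [/= ix jy] <-]|[_ _] [/= [x ix <-] [y jy <-]]].
  by split; [exists x|exists y].
by exists (x, y).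
Qed.

Lemma smooth_fun2_sum (R : realType) (d : nat) (M : manifold R d)
    (I : finType) (f g : I -> M -> R) :
  (forall k, smooth_fun (f k)) -> (forall k, smooth_fun (g k)) ->
  smooth_fun2 (fun p : M * M => \sum_k f k p.1 * g k p.2).
Proof.
move=> hf hg i j; have oU := @open_prod_image _ _ M i j.
apply: (@smooth_on_sum _ _ R^o) => // k; apply: smooth_on_mul => //.
- apply: (@smooth_on_comp _ _ 'rV[R]_d R^o _ (phi i @` dom i)
    (fun z : 'rV[R]_d * 'rV[R]_d => z.1) (f k \o psi i)) => //.
  + exact: has_coords_mx.
  + exact: has_coords_scalar.
  + by move=> _ [[x y] [/= ix jy] <-]; exists x.
  + by apply: smooth_on_fst => //; exact: smooth_on_id.
  + exact: hf.
- apply: (@smooth_on_comp _ _ 'rV[R]_d R^o _ (phi j @` dom j)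
    (fun z : 'rV[R]_d * 'rV[R]_d => z.2) (g k \o psi j)) => //.
  + exact: has_coords_mx.
  + exact: has_coords_scalar.
  + by move=> _ [[x y] [/= ix jy] <-]; exists y.
  + by apply: smooth_on_snd => //; exact: smooth_on_id.
  + exact: hg.
Qed.

Lemma smooth_fun_sum (R : realType) (d : nat) (M : manifold R d)
    (I : finType) (P : pred I) (f : I -> M -> R) :
  (forall k, smooth_fun (f k)) -> smooth_fun (fun x => \sum_(k | P k) f k x).
Proof.
by move=> hf i; apply: (@smooth_on_sum _ _ R^o) => [|k]; [exact: cod_open|exact: hf].
Qed.

(** * Density covers from colored hub extensions *)

Section hubs.
Context {R : realType} {d : nat} {M : manifold R d}.

(** Peaks at the points of a finite injective configuration, each vanishing
    near all the other points. *)
Lemma exists_peaks (V : finType) (alpha : V -> M) : injective alpha ->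
  exists f : V -> M -> R, [/\ forall a, smooth_fun (f a),
    forall a x, 0 <= f a x, forall a, 0 < f a (alpha a),
    forall a x, x != alpha a -> f a x < f a (alpha a) &
    forall a, \forall x \near alpha a, forall b, b != a -> f b x = 0].
Proof.
move=> inj.
have oO a : open (~` (alpha @` [set b | b != a])).
  apply: closed_openC.
  apply: (iffLR (@accessible_finite_set_closed M)).
    exact/hausdorff_accessible/manifold_hausdorff.
  by apply: finite_image; exact: finite_finset.
have aO a : (~` (alpha @` [set b | b != a])) (alpha a).
  by move=> [b /= ba /inj e]; rewrite e eqxx in ba.
have [f hf] := choice (fun a => exists_peak (oO a) (aO a)).
exists f; split=> [a|a|a|a|a]; try by have [] := hf a.
apply: filter_forall => b; have [->|ba] := eqVneq b a.
  by apply: nearW => x.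
have [_ _ _ _ [K [cK KO] Kf]] := hf b.
have : nbhs (alpha a) (~` K).
  apply: open_nbhs_nbhs; split; first exact: closed_openC.
  by move=> /KO; apply; exists a => //=; rewrite eq_sym.
by apply: filterS => x /Kf e _.
Qed.

(** For a color [j], the function [beta j] is the sum over the hubs [k] of color
    [j] of (sum of the peaks at the sources of [k])(x) times (sum of the peaks at
    the targets of [k])(y). Hubs of the same color share no source, so near
    [(alpha a, alpha b)] only the hub carrying the edge [(a, b)] contributes. *)
Lemma hub_density_cover (V : finType) (E : rel V) (alpha : V -> M)
    (H : finType) (E' : rel (V + H)) (h : nat) (color : H -> 'I_h) :
  (0 < d)%N -> injective alpha -> hub_extension E E' -> hub_coloring E' color ->
  exists beta : 'I_h -> M * M -> R,
    density_cover E alpha beta /\ forall j, rank_le #|H| (beta j).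
Proof.
move=> d0 inj [hub _] col; have [f [fs f0 fa fm fz]] := exists_peaks inj.
pose src j k x := \sum_(a | (color k == j) && E' (inl a) (inr k)) f a x.
pose tgt k y := \sum_(b | E' (inr k) (inl b)) f b y.
have ssrc j k : smooth_fun (src j k) by exact: smooth_fun_sum.
have stgt k : smooth_fun (tgt k) by exact: smooth_fun_sum.
exists (fun j p => \sum_k src j k p.1 * tgt k p.2); split; last first.
  move=> j; exists (fun k => src j (enum_val k)), (fun k => tgt (enum_val k)).
  by split=> // x y; rewrite (big_enum_val (fun k => src j k x * tgt k y)).
split=> [j|a b /hub[k0 [ak0 k0b]]]; first exact: smooth_fun2_sum.
exists (color k0).
apply: (@nonconstant_local_max_near _ _ (fun p => f a p.1 * f b p.2)); last first.
  apply: nonconstant_local_max_mul => //.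
  - by move=> z; exact: fm.
  - by move=> z; exact: fm.
exists ([set x | forall c, c != a -> f c x = 0],
        [set y | forall c, c != b -> f c y = 0]); first by split; exact: fz.
move=> [x y] /= [xa yb].
rewrite (bigD1 k0)//= [X in _ + X]big1 ?addr0 => [|k kk0].
  (* among the vertices only [a] contributes at [x], and only [b] at [y] *)
  rewrite /src /tgt (bigD1 a) ?eqxx//= big1 ?addr0; last first.
    by move=> c /andP[_ /xa].
  by rewrite (bigD1 b)//= big1 ?addr0// => c /andP[_ /yb].
(* another hub of the same color does not have [a] as a source *)
rewrite /src big1 ?mul0r// => c /andP[/eqP ck Eck]; apply: xa.
apply/eqP => ca; have := col _ _ kk0; rewrite ck eqxx => colk.
suff: ~~ true by []; apply: colk; left; exists a; split=> //.
by rewrite -ca.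
Qed.

End hubs.

(** * Euclidean parameter spaces and countable atlases *)

Lemma second_countable_rV (R : realType) (e : nat) :
  @second_countable 'rV[R]_e.
Proof.
pose b (p : 'rV[rat]_e * nat) : set 'rV[R]_e :=
  ball (map_mx ratr p.1 : 'rV[R]_e) p.2.+1%:R^-1.
exists (range b); first exact: card_le_trans (card_image_le _ _) (countableP _).
split=> [_ [p _ <-]|x A /nbhs_ballP[eps /= e0 eA]].
  exact: ball_open.
have [k ke] : exists k : nat, k.+1%:R^-1 < eps / 2.
  have [|k] := @ltr_add_invr R 0 (eps / 2); first by rewrite divr_gt0.
  by rewrite add0r; exists k.
have r0 : 0 < k.+1%:R^-1 :> R by rewrite invr_gt0.
have qP (i : 'I_e) : exists q : rat, `|x 0 i - ratr q| < k.+1%:R^-1.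
  have : x 0 i - k.+1%:R^-1 < x 0 i + k.+1%:R^-1.
    by rewrite ltrD2l gtrN.
  move=> /rat_in_itvoo[q]; rewrite in_itv/= => /andP[h1 h2]; exists q.
  by rewrite distrC ltr_distl h1 h2.
have [q hq] := choice qP.
have xq : `|x - map_mx ratr (\row_i q i)| < k.+1%:R^-1.
  rewrite [ltLHS]/Num.Def.normr/= mx_normrE; apply: bigmax_lt => // -[l i] _ /=.
  by rewrite !mxE (ord1 l).
exists (b (\row_i q i, k)) => /=.
  by split; [exists (\row_i q i, k)|rewrite /b -ball_normE/= distrC].
move=> y; rewrite /b -ball_normE/= => yq; apply: eA; rewrite -ball_normE/=.
rewrite -(subrKA (map_mx ratr (\row_i q i))) (splitr eps).
apply: le_lt_trans (ler_normD _ _) _.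
by apply: ltrD; [exact: lt_trans xq ke|exact: lt_trans yq ke].
Qed.

(** Euclidean space, with the identity as its only chart. *)
Definition euclidean (R : realType) (e : nat) : manifold R e.
Proof.
refine (@Manifold R e 'rV[R]_e unit (fun=> setT) (fun=> id) (fun=> id)
  _ _ _ _ _ _ _ _ _).
- by move=> _; exact: openT.
- by move=> _; rewrite image_id; exact: openT.
- by [].
- by move=> _ x _; exact: cvg_id.
- by move=> _ x _; exact: cvg_id.
- by move=> x; exists tt.
- by move=> _ _; exact: smooth_on_id.
- exact: norm_hausdorff.
- exact: second_countable_rV.
Defined.

Section families.
Context {R : realType} {d : nat} {M : manifold R d}.

(** Lindelof property: countably many chart domains cover a nonempty manifold. *)
Lemma countable_atlas (x0 : M) :
  exists c : nat -> chart M, forall x, exists n, dom (c n) x.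
Proof.
have [B /countable_injP[f finj] [Bo Bn]] := manifold_second_countable M.
have [i0 _] := dom_cover x0.
have hc n : exists i : chart M, forall U, B U -> f U = n ->
    (exists j : chart M, U `<=` dom j) -> U `<=` dom i.
  have [[U [BU fU [j Uj]]]|no] := pselect (exists U, [/\ B U, f U = n &
      exists j : chart M, U `<=` dom j]).
    exists j => U' BU' fU' _; rewrite (finj U' U)// ?inE//.
    by rewrite fU' fU.
  by exists i0 => U BU fU hj; exfalso; apply: no; exists U.
have [c cP] := choice hc; exists c => x; have [j jx] := dom_cover x.
have [U [BU Ux] Uj] : filter_from [set U | B U /\ U x] id (dom j).
  by apply: Bn; apply: open_nbhs_nbhs; split=> //; exact: dom_open.
by exists (f U); apply: (cP (f U) U) => //; exists j.
Qed.

(** The members of a smooth family are smooth sections. *)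
Lemma smooth_family_section (e : nat) (N : manifold R e) (P : set N)
    (u : N -> esection M) (t : N) :
  smooth_family P u -> P t -> smooth_section M (u t).
Proof.
move=> fam Pt i j; apply: smooth_on_local => _ [[x y] [/= ix jy] <-].
have [W [w [oW Wt sw wu]]] := fam t x y Pt.
have [k kt] := dom_cover t.
pose U := [set z : 'rV[R]_d * 'rV[R]_d | [/\ (phi i @` dom i) z.1,
  (phi j @` dom j) z.2 & W (t, psi i z.1, psi j z.2)]].
have oU : open U.
  rewrite openE => -[z1 z2] [/= iz jz Wz].
  have n1 : nbhs z1 (phi i @` dom i).
    by apply: open_nbhs_nbhs; split=> //; exact: cod_open.
  have n2 : nbhs z2 (phi j @` dom j).
    by apply: open_nbhs_nbhs; split=> //; exact: cod_open.
  have [[C D] [/= [[/= C1 C2] [/= nC1 nC2] CC] nD] CD] :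
      nbhs (t, psi i z1, psi j z2) W.
    exact: open_nbhs_nbhs.
  have n3 : nbhs z1 (psi i @^-1` C2) by exact: psi_continuous.
  have n4 : nbhs z2 (psi j @^-1` D) by exact: psi_continuous.
  exists ((phi i @` dom i) `&` psi i @^-1` C2, (phi j @` dom j) `&` psi j @^-1` D).
    by split; exact: filterI.
  move=> [w1 w2] [/= [iw Cw] [jw Dw]]; split => //.
  apply: (CD (_, _)); split => //; apply: (CC (_, _)); split => //=.
  exact: nbhs_singleton nC1.
exists U; split.
  by split=> /=; [exists x|exists y|rewrite !phiK].
pose F (z : 'rV[R]_e * 'rV[R]_d * 'rV[R]_d) :=
  w (psi k z.1.1) (psi i z.1.2) (psi j z.2) j.
pose iota (z : 'rV[R]_d * 'rV[R]_d) := (phi k t, z.1, z.2).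
have hiota : smooth_on U iota.
  apply: smooth_on_pair => //; last first.
    by apply: smooth_on_snd => //; exact: smooth_on_id.
  apply: smooth_on_pair => //; first exact: smooth_on_cst.
  by apply: smooth_on_fst => //; exact: smooth_on_id.
have key : smooth_on U (F \o iota).
  apply: smooth_on_comp (sw k i j) => //.
  - apply: has_coords_pair; last exact: has_coords_mx.
    by apply: has_coords_pair; exact: has_coords_mx.
  - exact: has_coords_mx.
  move=> z [iz jz Wz]; exists (t, psi i z.1, psi j z.2).
    by split=> //; split=> /=; [split|]=> //=; exact: psi_dom.
  by rewrite /= !psiK.
apply: smooth_on_eq oU _ key => z [iz jz Wz].
by rewrite /F /= phiK// (wu t).
Qed.

End families.

(** * Laws with prescribed maximum and direction *)

Section frames.
Context {R : realType} {d : nat} {M : manifold R d}.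
Implicit Types (g : riemannian M) (x y : M) (i j m : chart M).

Lemma tangent_ext y (u v : tangent y) : (forall j, u j = v j) -> u = v.
Proof. by move=> h; apply/val_inj/funext. Qed.

Lemma derive_transition_id m y (v : 'rV[R]_d) : dom m y ->
  'D_v (phi m \o psi m) (phi m y) = v.
Proof.
move=> my; rewrite -[RHS](derive_id (phi m y) v); apply: near_eq_derive.
have : nbhs (phi m y) (phi m @` dom m).
  by apply: open_nbhs_nbhs; split; [exact: cod_open|exists y].
by apply: filterS => z mz; rewrite /= psiK.
Qed.

(** The coordinate in the chart [j] of the vector at [y] whose coordinate in the
    chart [m] is [v], and zero unless both charts contain [y]. *)
Definition const_field_coord m (v : 'rV[R]_d) y j : 'rV[R]_d :=
  if `[< dom j y >] && `[< dom m y >]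
  then 'D_v (phi j \o psi m) (phi m y) else 0.

Lemma const_field_compat m v y :
  (const_field_coord m v y) \in tangent_pred y.
Proof.
apply/asboolP; rewrite /const_field_coord; split=> [i iy|i j iy jy].
  by rewrite (asboolF iy).
rewrite !(asboolT iy) !(asboolT jy) /=.
have [my|my] := pselect (dom m y); last first.
  by rewrite (asboolF my) derive0.
rewrite (asboolT my).
have dT k l : dom k y -> dom l y ->
    differentiable (phi l \o psi k : 'rV[R]_d -> 'rV[R]_d) (phi k y).
  move=> ky ly; apply: (smooth_on_differentiable (transition_smooth k l)).
  by exists y.
have psi_m : psi m (phi m y) = y by rewrite phiK.
have dij : differentiable (phi j \o psi i) ((phi i \o psi m) (phi m y)).
  by rewrite /= psi_m; exact: dT.
have dmi := dT _ _ my iy.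
have -> : 'D_v (phi j \o psi m) (phi m y) =
    'D_v ((phi j \o psi i) \o (phi i \o psi m)) (phi m y).
  apply: near_eq_derive.
  have : nbhs (phi m y) (phi m @` (dom m `&` dom i)).
    apply: open_nbhs_nbhs; split; first exact/open_chart_image/dom_open.
    by exists y.
  by apply: filterS => z /chart_imageP[mz iz]; rewrite /= phiK.
by rewrite (derive_comp v dmi dij) /= psi_m.
Qed.

(** The vector field with constant coordinates [v] in the chart [m], extended
    by zero off the chart domain. *)
Definition const_field m v y : tangent y := Tangent (const_field_compat m v y).

Lemma const_fieldE m v y j : dom m y -> dom j y ->
  const_field m v y j = 'D_v (phi j \o psi m) (phi m y).
Proof.
by move=> my jy; rewrite /= /const_field_coord (asboolT my) (asboolT jy).
Qed.

Lemma const_field_self m v y : dom m y -> const_field m v y m = v.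
Proof. by move=> my; rewrite const_fieldE// derive_transition_id. Qed.

Lemma const_field_tangent m y (v : tangent y) : dom m y ->
  const_field m (v m) y = v.
Proof.
move=> my; have /asboolP[v0 vD] := tangentP v.
apply: tangent_ext => j; have [jy|jy] := pselect (dom j y).
  by rewrite const_fieldE// -vD.
by rewrite (v0 j jy) /= /const_field_coord (asboolF jy).
Qed.

Lemma const_field_neq0 m v y : dom m y -> v != 0 -> const_field m v y != 0.
Proof.
by move=> my; apply: contra => /eqP e; rewrite -(const_field_self v my) e.
Qed.

Lemma metric_scale g y (a b : R) (u : tangent y) :
  metric g (a *: u) (b *: u) = a * b * metric g u u.
Proof.
have z (w : tangent y) : metric g 0 w = 0.
  have := metric_linear g 1 0 0 w; rewrite scaler0 addr0 mul1r => e.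
  by apply: (addrI (metric g 0 w)); rewrite addr0 -e.
have l c (w t : tangent y) : metric g (c *: w) t = c * metric g w t.
  by have := metric_linear g c w 0 t; rewrite z !addr0.
by rewrite l Defs.metric_sym l mulrA.
Qed.

Lemma tnorm_scale g y (a : R) (u : tangent y) : 0 <= a ->
  tnorm g (a *: u) = a * tnorm g u.
Proof.
move=> a0; rewrite /tnorm metric_scale -expr2 sqrtrM ?sqr_ge0//.
by rewrite sqrtr_sqr ger0_norm.
Qed.

Lemma tnorm_gt0 g y (u : tangent y) : u != 0 -> 0 < tnorm g u.
Proof. by move=> u0; rewrite /tnorm sqrtr_gt0 metric_pos. Qed.

(** A bump in [x] centered at [a] in the chart [i], times a bump in [y] centered at
    [b] in the chart [m], times the normalized field of constant direction [v] in
    the chart [m]. *)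
Definition law g i m (r : R) (a b v : 'rV[R]_d) : esection M :=
  fun x y => (bump i r a x * bump m r b y * (tnorm g (const_field m v y))^-1)
             *: const_field m v y.

(** The normalization leaves the product of the bumps as the norm. *)
Lemma section_norm_law g i m r a b v : v != 0 ->
  section_norm g (law g i m r a b v) =
    fun p => bump i r a p.1 * bump m r b p.2.
Proof.
move=> v0; apply/funext => -[x y]; rewrite /section_norm /law/=.
have b0 := mulr_ge0 (bump_ge0 i r a x) (bump_ge0 m r b y).
rewrite tnorm_scale; last by rewrite mulr_ge0// invr_ge0 sqrtr_ge0.
have [my|my] := pselect (dom m y); last by rewrite (bump_out _ _ my) mulr0 !mul0r.
by rewrite mulfVK// gt_eqF// tnorm_gt0// const_field_neq0.
Qed.

(** Smoothness of a law jointly in its parameters and in the points, where all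
    of them depend smoothly on a further variable. *)
Lemma smooth_on_law (V : normedModType R) (U : set V) g i m i' j (r : R)
    (A B W X Y : V -> 'rV[R]_d) : open U ->
  (forall z, U z -> (phi i' @` (dom i' `&` dom i)) (X z)) ->
  (forall z, U z -> (phi j @` (dom j `&` dom m)) (Y z)) ->
  (forall z, U z -> W z != 0) ->
  smooth_on U A -> smooth_on U B -> smooth_on U W -> smooth_on U X ->
  smooth_on U Y ->
  smooth_on U
    (fun z => law g i m r (A z) (B z) (W z) (psi i' (X z)) (psi j (Y z)) j).
Proof.
move=> oU UX UY W0 hA hB hW hX hY.
have cmx n k : has_coords 'M[R]_(n, k) by exact: has_coords_mx.
have my z : U z -> dom m (psi j (Y z)) by move=> /UY/chart_imageP[].
have jy z : U z -> dom j (psi j (Y z)).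
  by move=> /UY/chart_imageP[/psi_dom].
have hphi : smooth_on U (fun z => phi m (psi j (Y z))).
  exact: (smooth_on_comp (cmx _ _) (cmx _ _) oU UY hY (transition_smooth j m)).
have [G [sG GE]] := metric_smooth g m.
have hG : smooth_on U (fun z => G (phi m (psi j (Y z)))).
  apply: (smooth_on_comp (cmx _ _) (cmx _ _) oU _ hphi sG) => z Uz.
  exists (psi j (Y z)) => //.
  exact: my.
pose q z := metric g (const_field m (W z) (psi j (Y z)))
                     (const_field m (W z) (psi j (Y z))).
have hq : smooth_on U (q : V -> R^o).
  have key : smooth_on U ((fun z => (W z *m G (phi m (psi j (Y z))) *m (W z)^T) 0 0)
      : V -> R^o).
    apply: smooth_on_coord => //; apply: smooth_on_mulmx => //.
      exact: smooth_on_mulmx.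
    exact: smooth_on_trmx.
  apply: smooth_on_eq oU _ key => z Uz.
  by rewrite /q (GE _ _ _ (my _ Uz)) const_field_self//; exact: my.
have hr : smooth_on U ((fun z => (Num.sqrt (q z))^-1) : V -> R^o).
  apply: smooth_on_rsqrt => // z Uz; apply: metric_pos.
  by apply: const_field_neq0; [exact: my|exact: W0].
have hD : smooth_on U (fun z => const_field m (W z) (psi j (Y z)) j).
  have [I [e [c [cc ce]]]] := cmx 1%N d.
  have key : smooth_on U (fun z =>
      \sum_k c k (W z) *: 'D_(e k) (phi j \o psi m) (phi m (psi j (Y z)))).
    apply: smooth_on_sum => // k; apply: (smooth_on_scale (cmx _ _)) => //.
      exact: (smooth_on_lin (L := c k)).
    have hDk := smooth_on_derive (e k) (transition_smooth m j).
    apply: (smooth_on_comp (cmx _ _) (cmx _ _) oU _ hphi hDk) => z Uz.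
     exists (psi j (Y z)) => //.
    by split; [exact: my|exact: jy].
  apply: smooth_on_eq oU _ key => z Uz.
  have [mz jz] := (my _ Uz, jy _ Uz).
  rewrite const_fieldE// -(deriveE_coords _ ce)//.
  apply: (smooth_on_differentiable (transition_smooth m j)).
  by exists (psi j (Y z)).
apply: (smooth_on_scale (cmx _ _) (f := fun z => bump i r (A z) (psi i' (X z)) *
  bump m r (B z) (psi j (Y z)) * (Num.sqrt (q z))^-1)) => //.
by apply: smooth_on_mul => //; apply: smooth_on_mul => //; exact: smooth_on_bump.
Qed.

End frames.

(** * The universal family *)

Section family.
Context {R : realType} {d : nat} {M : manifold R d}.
Context (g : riemannian M) (c : nat -> chart M).

(** A parameter is a vector [(p, a, b, v)]: the natural number [p], stored as a
    real coordinate, codes two charts of the sequence [c] and a radius, [a] and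
    [b] are the centers of the two bumps and [v] is a direction. *)
Notation param := ('rV[R]_(1 + (d + (d + d)))).

(** The two chart indices and the index of the radius. A first
    coordinate that codes no triple is sent to [(0, 0, 0)]. *)
Definition code (t : param) : nat * nat * nat :=
  odflt (0, 0, 0)%N (unpickle (Num.truncn (t 0 0))).

Definition chart1 (q : nat * nat * nat) := c q.1.1.
Definition chart2 (q : nat * nat * nat) := c q.1.2.
Definition radius (q : nat * nat * nat) : R := q.2.+1%:R^-1.

Definition center1 (t : param) : 'rV[R]_d := lsubmx (rsubmx t).
Definition center2 (t : param) : 'rV[R]_d := lsubmx (rsubmx (rsubmx t)).
Definition direction (t : param) : 'rV[R]_d := rsubmx (rsubmx (rsubmx t)).

(** The law with the discrete part [q] of the parameter fixed: over the two chart
    domains it extends [law_family] smoothly around parameters of code [q]. *)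
Definition law_of (q : nat * nat * nat) (t : param) : esection M :=
  law g (chart1 q) (chart2 q) (radius q) (center1 t) (center2 t) (direction t).

Definition law_family (t : param) : esection M := law_of (code t) t.

(** The parameter set. The balls have twice the radius of the bumps, to leave
    room for the centers to move. *)
Definition good_param : set param := [set t : param |
  [/\ exists p : nat, t 0 0 = p%:R, direction t != 0,
      cball (center1 t) (radius (code t) *+ 2) `<=`
        phi (chart1 (code t)) @` dom (chart1 (code t)) &
      cball (center2 t) (radius (code t) *+ 2) `<=`
        phi (chart2 (code t)) @` dom (chart2 (code t))]].

Lemma radius_gt0 q : 0 < radius q.
Proof. by rewrite invr_gt0. Qed.

(** The discrete part is locally constant on the parameter set. *)
Lemma code_near (t t' : param) : good_param t -> good_param t' ->
  `|t' 0 0 - t 0 0| < 2^-1 -> code t' = code t.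
Proof.
rewrite /code => -[[p ->] _ _ _] [[p' ->] _ _ _] h; rewrite !natrK.
suff -> : p' = p by [].
have [pp|pp|//] := ltngtP p' p; exfalso; move: h.
- have h1 : p'%:R + 1 <= p%:R :> R by rewrite natr1 ler_nat.
  by rewrite ltr_norml => /andP[? ?]; lra.
- have h1 : p%:R + 1 <= p'%:R :> R by rewrite natr1 ler_nat.
  by rewrite ltr_norml => /andP[? ?]; lra.
Qed.

Lemma continuous_center1 : continuous center1.
Proof.
move=> t; apply: (@continuous_comp _ _ _ rsubmx lsubmx).
  exact: continuous_rsubmx.
exact: continuous_lsubmx.
Qed.

Lemma continuous_direction : continuous direction.
Proof.
move=> t; apply: (@continuous_comp _ _ _ rsubmx (rsubmx \o rsubmx)).
  exact: continuous_rsubmx.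
by apply: continuous_comp; exact: continuous_rsubmx.
Qed.

Lemma continuous_center2 : continuous center2.
Proof.
move=> t; apply: (@continuous_comp _ _ _ rsubmx (lsubmx \o rsubmx)).
  exact: continuous_rsubmx.
by apply: continuous_comp; [exact: continuous_rsubmx|exact: continuous_lsubmx].
Qed.

Lemma near_param (t : param) :
  nbhs t [set t' : param | `|t' 0 0 - t 0 0| < 2^-1].
Proof.
have ct : (fun t' : param => t' 0 0) @ t --> t 0 0 by exact: coord_continuous.
have h2 : 0 < 2^-1 :> R by rewrite invr_gt0.
have /cvgrPdist_lt/(_ _ h2) := ct.
by apply: filterS => t' /=; rewrite distrC.
Qed.

(** Away from the support, a bump stays zero when its center moves slightly. *)
Lemma bump_vanishes_near i r (a : 'rV[R]_d) (x : M) : 0 < r ->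
  cball a (r *+ 2) `<=` phi i @` dom i -> ~ dom i x ->
  exists2 O : set M, open O /\ O x &
    forall a' x', `|a' - a| < r -> O x' -> bump i r a' x' = 0.
Proof.
move=> r0 sub ix; exists (~` (psi i @` cball a (r *+ 2))).
  split; first exact/closed_openC/closed_chart_cball.
  by move=> [z /sub iz e]; apply: ix; rewrite -e; exact: psi_dom.
move=> a' x' aa Kx; apply: bump_support => // -[z za' e]; apply: Kx.
exists z => //; rewrite /cball/= -(subrKA a') mulr2n.
by apply: le_trans (ler_normD _ _) _; apply: lerD => //; exact: ltW.
Qed.

Lemma smooth_law_family :
  smooth_family (N := euclidean R _) good_param law_family.
Proof.
move=> t x y Pt; have [_ v0 sub1 sub2] := Pt; set q := code t in sub1 sub2 *.
pose T0 := [set t' : param | `|t' 0 0 - t 0 0| < 2^-1].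
have qT0 t' : good_param t' -> T0 t' -> code t' = q by move=> Pt'; exact: code_near.
have nzero (W : set (euclidean R (1 + (d + (d + d))) * M * M)) :
    smooth_family_on W (fun _ _ _ => 0).
  move=> k i j; exact: smooth_on_cst.
(* local extension when [x] or [y] is off its chart: the zero family *)
have away (S : set param) (N1 N2 : set M) : nbhs t S -> open N1 -> N1 x ->
    open N2 -> N2 y ->
    (forall t' x' y', good_param t' -> T0 t' -> S t' -> N1 x' -> N2 y' ->
       law_family t' x' y' = 0) ->
    exists (W : set (euclidean R (1 + (d + (d + d))) * M * M))
      (w : euclidean R (1 + (d + (d + d))) -> esection M),
    [/\ open W, W (t, x, y), smooth_family_on W w &
      forall t' x' y', good_param t' -> W (t', x', y') ->
        w t' x' y' = law_family t' x' y'].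
  move=> nS oN1 N1x oN2 N2y h.
  have n0 : nbhs t ((S `&` T0)^°).
    by apply/nbhs_interior/filterI => //; exact: near_param.
  exists ((S `&` T0)^° `*` N1 `*` N2), (fun _ _ _ => 0); split => //.
  - by apply: open_setX => //; apply: open_setX => //; exact: open_interior.
  - by split=> //; split=> //; exact: nbhs_singleton n0.
  - move=> t' x' y' Pt' [[/= /interior_subset [St' Tt'] N1x'] N2y'].
    by rewrite (h t').
have [ix|ix] := pselect (dom (chart1 q) x); last first.
  have [N1 [oN1 N1x] hN1] := bump_vanishes_near (radius_gt0 q) sub1 ix.
  apply: (away (center1 @^-1` [set a | `|a - center1 t| < radius q]) N1 setT) => //.
  - apply: continuous_center1.
    have : nbhs (center1 t) (ball (center1 t) (radius q)).
      exact: nbhsx_ballx (radius_gt0 q).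
    by apply: filterS => a; rewrite -ball_normE/= distrC.
  - exact: openT.
  - move=> t' x' y' Pt' Tt' ct' Ox' _; rewrite /law_family (qT0 _ Pt' Tt').
    by rewrite /law_of /law hN1// !mul0r scale0r.
have [jy|jy] := pselect (dom (chart2 q) y); last first.
  have [N2 [oN2 N2y] hN2] := bump_vanishes_near (radius_gt0 q) sub2 jy.
  apply: (away (center2 @^-1` [set a | `|a - center2 t| < radius q]) setT N2) => //.
  - apply: continuous_center2.
    have : nbhs (center2 t) (ball (center2 t) (radius q)).
      exact: nbhsx_ballx (radius_gt0 q).
    by apply: filterS => a; rewrite -ball_normE/= distrC.
  - exact: openT.
  - move=> t' x' y' Pt' Tt' ct' _ Oy'; rewrite /law_family (qT0 _ Pt' Tt').
    by rewrite /law_of /law hN2// mulr0 !mul0r scale0r.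
pose T1 := [set t' : param | direction t' != 0].
have oT1 : open T1.
  have := open_comp (f := direction) (D := ~` [set 0]).
  move=> /(_ (fun z _ => @continuous_direction z)).
  rewrite (_ : _ @^-1` _ = T1).
    apply; apply: closed_openC.
    exact/accessible_closed_set1/hausdorff_accessible/norm_hausdorff.
  by apply/seteqP; split=> z /= /eqP.
exists ((T0^° `&` T1) `*` dom (chart1 q) `*` dom (chart2 q)), (law_of q); split.
- apply: open_setX; last exact: dom_open.
  apply: open_setX; last exact: dom_open.
  by apply: openI => //; exact: open_interior.
- do 2!split=> //=; split=> //; apply: nbhs_singleton.
  exact/nbhs_interior/near_param.
- move=> k i j.
  pose U := [set z : param * 'rV[R]_d * 'rV[R]_d | [/\ direction z.1.1 != 0,
    (phi i @` (dom i `&` dom (chart1 q))) z.1.2 &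
    (phi j @` (dom j `&` dom (chart2 q))) z.2]].
  have oU : open U.
    rewrite (_ : U = T1 `*` (phi i @` (dom i `&` dom (chart1 q))) `*`
      (phi j @` (dom j `&` dom (chart2 q)))).
      apply: open_setX; last exact/open_chart_image/dom_open.
      by apply: open_setX => //; exact/open_chart_image/dom_open.
    by apply/seteqP; split=> [z []|z [[]]].
  have h1 : smooth_on U (fun z => z.1).
    by apply: smooth_on_fst => //; exact: smooth_on_id.
  have h11 : smooth_on U (fun z => z.1.1) by exact: smooth_on_fst.
  apply: (@smooth_on_subset _ _ _ U).
    move=> _ [[[t' x'] y'] [[[/= [_ Tt'] ix'] jy'] [[_ iix'] jjy']] <-].
    by split=> //=; [exists x'|exists y'].
  apply: smooth_on_law => //; try by move=> z [].
  + by apply: smooth_on_lsubmx => //; exact: smooth_on_rsubmx.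
  + by apply: smooth_on_lsubmx => //; do 2!apply: smooth_on_rsubmx => //.
  + by do 3!apply: smooth_on_rsubmx => //.
  + exact: smooth_on_snd.
  + by apply: smooth_on_snd => //; exact: smooth_on_id.
- move=> t' x' y' Pt' [[/= [Tt' _] _] _]; rewrite /law_family (qT0 t')//.
  exact: interior_subset Tt'.
Qed.

(** Small enough balls around the coordinates of a point lie in the chart. *)
Lemma exists_radius (i : chart M) (x : M) : dom i x ->
  exists k : nat, forall l, (k <= l)%N ->
    cball (phi i x) (l.+1%:R^-1 *+ 2) `<=` phi i @` dom i.
Proof.
move=> ix; have /nbhs_normP[e /= e0 eO] : nbhs (phi i x) (phi i @` dom i).
  by apply: open_nbhs_nbhs; split; [exact: cod_open|exists x].
have [|k] := @ltr_add_invr R 0 (e / 2); first by rewrite divr_gt0.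
rewrite add0r => ke; exists k => l kl z zr; apply: eO; rewrite /ball_/= distrC.
apply: le_lt_trans zr _; rewrite mulr2n (splitr e).
have lk : l.+1%:R^-1 < e / 2.
  by apply: le_lt_trans ke; rewrite lef_pV2 ?posrE// ler_nat.
exact: ltrD.
Qed.

(** A nonzero tangent vector only exists in positive dimension, where a product of
    bumps is not locally constant at its maximum. *)
Lemma law_family_strong (x y : M) (v : tangent y) :
  (forall z, exists n, dom (c n) z) -> v != 0 ->
  exists2 t : param, good_param t &
    strong g (law_family t) x y /\
    exists e : R, 0 < e /\ law_family t x y = e *: v.
Proof.
move=> cov v0; have [n nx] := cov x; have [m my] := cov y.
have [k1 hk1] := exists_radius nx; have [k2 hk2] := exists_radius my.
have vm0 : v (c m) != 0.
  apply: contra v0 => /eqP e; apply/eqP.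
  rewrite -(const_field_tangent v my) e; apply: tangent_ext => j.
  have [jy|jy] := pselect (dom j y); first by rewrite const_fieldE// derive0.
  by rewrite /= /const_field_coord (asboolF jy).
have d0 : (0 < d)%N.
  rewrite lt0n; apply: contra vm0 => /eqP d0; apply/eqP/rowP => k.
  by case: k => k kd; exfalso; rewrite d0 in kd.
pose q := (n, m, maxn k1 k2).
pose t : param := row_mx (pickle q)%:R%:M
  (row_mx (phi (c n) x) (row_mx (phi (c m) y) (v (c m)))).
have t00 : t 0 0 = (pickle q)%:R.
  have -> : (0 : 'I_(1 + (d + (d + d)))) = lshift (d + (d + d)) (0 : 'I_1).
    exact: val_inj.
  by rewrite /t row_mxEl mxE eqxx.
have codet : code t = q by rewrite /code t00 natrK pickleK.
have c1 : center1 t = phi (c n) x by rewrite /center1 row_mxKr row_mxKl.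
have c2 : center2 t = phi (c m) y by rewrite /center2 !row_mxKr row_mxKl.
have dt : direction t = v (c m) by rewrite /direction !row_mxKr.
have r0 := radius_gt0 q.
exists t.
  split; rewrite ?codet ?c1 ?c2 ?dt//; first by exists (pickle q).
  - by apply: hk1; rewrite /= leq_maxl.
  - by apply: hk2; rewrite /= leq_maxr.
have lawt : law_family t = law g (c n) (c m) (radius q) (phi (c n) x)
    (phi (c m) y) (v (c m)).
  by rewrite /law_family codet /law_of c1 c2 dt.
rewrite lawt; split.
  rewrite /strong section_norm_law//; apply: nonconstant_local_max_mul => //.
  - by move=> z; exact: bump_ge0.
  - by move=> z; exact: bump_ge0.
  - exact: bump_center_gt0.
  - by move=> z; exact: bump_lt.
  - by move=> z; exact: bump_lt.
rewrite /law const_field_tangent//; eexists; split; last by [].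
by rewrite !mulr_gt0// ?invr_gt0 ?tnorm_gt0//; exact: bump_center_gt0.
Qed.

End family.

(** Without a point in [M] the empty family works; otherwise the family is
    [law_family] for a countable atlas. *)
Lemma exists_universal_family (R : realType) (d : nat) (M : manifold R d)
    (g : riemannian M) (r0 : R) :
  exists I : set (esection M),
    [/\ I `<=` smooth_section M, finitely_parametrized I & universal g r0 I].
Proof.
have univ1 (I : set (esection M)) : exists C : R, 0 < C /\
    forall (V : finType) (E : rel V) (alpha : V -> M),
      #|V|%:R < C -> admissible g r0 alpha -> contains_density_cover g I E alpha.
  (* for C = 1 only the empty digraph is concerned, and the empty collection
     is a density cover of it *)
  exists 1; split=> // V E alpha; rewrite ltrn1 ltnS leqn0 => /eqP V0 _.
  have noV (a : V) : False by case: (fintype0 a V0).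
  by exists 0%N, (fun=> fun _ _ => 0); split=> [[]//|]; split=> [[]//|a]; case: (noV a).
have [[x0 _]|noM] := pselect (exists x : M, True); last first.
  exists set0; split; first by [].
    exists 0%N, (fun=> 0%N), (fun=> euclidean R 0), (fun=> set0),
      (fun=> fun _ _ _ => 0).
    by split=> [[]//|]; apply/seteqP; split=> // u [[]].
  by split=> // x; exfalso; apply: noM; exists x.
have [c cov] := countable_atlas x0.
have fam := @smooth_law_family _ _ _ g c.
exists (law_family g c @` good_param c); split.
- by move=> _ [t Pt <-]; exact: smooth_family_section fam Pt.
- exists 1%N, (fun=> (1 + (d + (d + d)))%N), (fun=> euclidean R _),
    (fun=> good_param c), (fun=> law_family g c); split=> [_|]; first exact: fam.
  by rewrite bigcup_const//; exists ord0.
- split=> // x y v v0; have [t Pt [st ct]] := law_family_strong g x cov v0.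
  by exists (law_family g c t); split=> //; exists t.
Qed.

Unset Implicit Arguments.

Theorem theorem1p10 (R : realType) (d : nat) (M : manifold R d)
    (g : riemannian M) (r0 : R) (r0_gt0 : 0 < r0) :
  (exists I : set (esection M),
     [/\ I `<=` smooth_section M, finitely_parametrized I &
         universal g r0 I]) /\
  ((0 < d)%N ->
   forall (V : finType) (E : rel V) (alpha : V -> M),
     admissible g r0 alpha ->
   forall (H : finType) (E' : rel (V + H)) (h : nat) (color : H -> 'I_h),
     hub_extension E E' -> hub_coloring E' color ->
   exists beta : 'I_h -> M * M -> R,
     density_cover E alpha beta /\ forall j, rank_le #|H| (beta j)).
Proof.
split; first exact: exists_universal_family.
by move=> d0 V E alpha [inj _] H E' h color; exact: hub_density_cover.
Qed.
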